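(* Let $n\ge2$, let $X=(X_1,\dots,X_n)$ be an unconditional and isotropic random vector in $\mathbb{R}^n$, let $\theta\in S^{n-1}$ be fixed, and let $W_\theta=\langle X,\theta\rangle$. Then $$\sup_{t\in\mathbb{R}}\bigl|\mathbb{P}[W_\theta\le t]-\Phi(t)\bigr|\le 2\sqrt{\Bigl(\max_{1\le i\le n}\mathbb{E}X_i^4\Bigr)\|\theta\|_4^4+\max_{i\ne j}\operatorname{Cov}(X_i^2,X_j^2)}+\left(\frac{8}{\pi}\right)^{1/4}\left(\max_{1\le i\le n}\sqrt{\mathbb{E}|X_i|^3}\right)\|\theta\|_3^{3/2}.$$ If moreover $X\in[-a,a]^n$ almost surely, then $$\sup_{t\in\mathbb{R}}\bigl|\mathbb{P}[W_\theta\le t]-\Phi(t)\bigr|\le 24\sqrt{\Bigl(\max_{1\le i\le n}\mathbb{E}X_i^4\Bigr)\|\theta\|_4^4+\max_{i\ne j}\operatorname{Cov}(X_i^2,X_j^2)}+172\,n\,a^3\|\theta\|_\infty^3.$$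
   Context: $\langle\cdot,\cdot\rangle$ is the standard inner product on $\mathbb{R}^n$, $S^{n-1}$ the Euclidean unit sphere, $\Phi$ the standard normal distribution function, $\|x\|_p=(\sum_i|x_i|^p)^{1/p}$ for $1\le p<\infty$ and $\|x\|_\infty=\max_i|x_i|$. $X$ is isotropic if $\mathbb{E}X_i=0$ and $\mathbb{E}X_iX_j=\delta_{ij}$ for all $i,j$. $X$ is unconditional if its distribution is invariant under reflections in the coordinate hyperplanes, i.e. $X$ has the same distribution as $(\varepsilon_1X_1,\dots,\varepsilon_nX_n)$ for every $\varepsilon\in\{-1,1\}^n$. $\operatorname{Cov}(X_i^2,X_j^2)=\mathbb{E}X_i^2X_j^2-(\mathbb{E}X_i^2)(\mathbb{E}X_j^2)$. If some moment on a right-hand side is infinite, the bound is understood as $+\infty$. *)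

(* Defs.v *)
(* A vector of R^n is an [n.-tuple R], the library's
   carrier of the product sigma-algebra generated by the coordinates; a random
   vector is thus a random variable [X : {RV P >-> n.-tuple R}]. *)
From HB Require Import structures.
From mathcomp Require Import all_boot all_order all_algebra.
From mathcomp Require Import all_classical all_reals all_analysis.

Set Implicit Arguments.
Unset Strict Implicit.
Unset Printing Implicit Defensive.

Import Order.TTheory GRing.Theory Num.Theory.
Import numFieldNormedType.Exports.

Local Open Scope classical_set_scope.
Local Open Scope ring_scope.

Section vectors.
Context {R : realType} {n : nat}.
Implicit Types x y : n.-tuple R.

Definition dot x y : R := \sum_(i < n) tnth x i * tnth y i.

Definition lpnorm (p : R) x : R :=
  (\sum_(i < n) `|tnth x i| `^ p) `^ p^-1.

Definition linfnorm x : R := \big[Num.max/0]_(i < n) `|tnth x i|.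

(* The sign vector of {-1,1}^n is (-1)^(e i), with e i boolean. *)
Definition sign_flip (e : 'I_n -> bool) x : n.-tuple R :=
  [tuple (-1) ^+ e i * tnth x i | i < n].

End vectors.

Section random_vectors.
Local Open Scope ereal_scope.
Context {d : measure_display} {T : measurableType d} {R : realType}.

Definition component {n : nat} (X : T -> n.-tuple R) (i : 'I_n) (w : T) : R :=
  tnth (X w) i.

Context (P : probability T R).

Definition isotropic {n : nat} (X : {RV P >-> n.-tuple R}) : Prop :=
  (forall i, 'E_P[component X i] = 0) /\
  (forall i j, 'E_P[fun w => (component X i w * component X j w)%R] =
               ((i == j)%:R)%:E).

Definition unconditional {n : nat} (X : {RV P >-> n.-tuple R}) : Prop :=
  forall (e : 'I_n -> bool) (A : set (n.-tuple R)), measurable A ->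
    pushforward P (sign_flip e \o X) A = pushforward P X A.

(* Agrees with the library's [covariance] in the integrable case, see [covE];
   unlike the latter it is +oo by definition when E[Y] and E[Z] are finite but
   E[Y Z] = +oo. *)
Definition cov (Y Z : T -> R) : \bar R :=
  'E_P[fun w => (Y w * Z w)%R] - 'E_P[Y] * 'E_P[Z].

Lemma covE (Y Z : T -> R) :
  Y \in Lfun P 1 -> Z \in Lfun P 1 -> (Y * Z)%R \in Lfun P 1 ->
  cov Y Z = covariance P Y Z.
Proof. by move=> Y1 Z1 YZ1; rewrite covarianceE. Qed.

Definition std_normal_cdf (t : R) : \bar R :=
  normal_prob 0%R 1%R `]-oo, t]%classic.

Definition dist_to_normal (W : T -> R) : \bar R :=
  ereal_sup [set `|P [set w | (W w <= t)%R] - std_normal_cdf t| | t in setT].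

(* The neutral element -oo of the maxima below is irrelevant for n >= 2, where
   the index sets are nonempty. *)
Definition max_moment4 {n : nat} (X : {RV P >-> n.-tuple R}) : \bar R :=
  \big[maxe/-oo]_(i < n) 'E_P[fun w => (component X i w ^+ 4)%R].

Definition max_cov_sqr {n : nat} (X : {RV P >-> n.-tuple R}) : \bar R :=
  \big[maxe/-oo]_(ij : 'I_n * 'I_n | ij.1 != ij.2)
    cov (fun w => component X ij.1 w ^+ 2)%R (fun w => component X ij.2 w ^+ 2)%R.

Definition max_sqrt_moment3 {n : nat} (X : {RV P >-> n.-tuple R}) : \bar R :=
  \big[maxe/-oo]_(i < n) sqrte 'E_P[fun w => (`|component X i w| ^+ 3)%R].

End random_vectors.

(* Main.v *)
Require Import Defs.
From HB Require Import structures.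
From mathcomp Require Import all_boot all_order all_algebra.
From mathcomp Require Import all_classical all_reals all_analysis.
From mathcomp Require Import measurable_realfun.
From mathcomp Require Import ring lra.

(** The proof is Stein's method for the exchangeable pairs obtained by reflecting
one coordinate, in a form that needs neither smoothing nor a concentration
inequality.

Write [Y_i = theta_i X_i], so that [W] is the sum of the [Y_i], and let
[W_i = W - 2 Y_i] be the value of [W] after a reflection of the [i]-th
coordinate. For fixed [t] the bounded solution [f] of the Stein equation
[f' (w) - w f (w) = 1 (w <= t) - Phi t] turns [P (W <= t) - Phi t] into
[E (f' (W) - W f (W))]. Unconditionality allows one to average over each
reflection, which gives
[E (Y_i f (W)) = E (Y_i (f (W) - f (W_i))) / 2] and
[E (Y_i^2 f' (W)) = E (Y_i^2 (f' (W) + f' (W_i))) / 2], so that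
[E (f' (W) - W f (W))] is the sum of [E (f' (W) (1 - sum_i Y_i^2))] and of
[sum_i E (Y_i^2 (f' (W) + f' (W_i)) - Y_i (f (W) - f (W_i))) / 2].

Since [|f'| <= 1], the first term is at most [E |1 - sum_i Y_i^2|], which the
Cauchy-Schwarz inequality bounds by the fourth moments and the covariances of
squares ([variance_le]). The [i]-th part of the second term is the error of the
trapezoid rule for [f'] between [W_i] and [W]. Now [f' = g + 1 (. <= t) - Phi t]
where [g (w) = w f (w)] is nondecreasing by the classical estimates of Mills
ratios. So this error is at most [Y_i^2 |p (W) - p (W_i)| / 2], where [p] is
[g - 1 (. <= t)] up to a constant, a nondecreasing function with values in
[-1, 1] ([stein_solution]).

Let [s (y) = y min (|y|, K)]. As [p] is nondecreasing, [p (W) - p (W_i)] has the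
sign of [Y_i], hence [Y_i^2 |p (W) - p (W_i)|] is at most
[s (Y_i) (p (W) - p (W_i)) + 2 (Y_i^2 - |s (Y_i)|)], and because [s] is odd a
last reflection turns the expectation of the first summand into
[2 E (s (Y_i) p (W))]. Summing over [i] yields [stein_bound]: the distance at [t]
is at most [E |1 - sum_i Y_i^2| + sum_i E (Y_i^2 - |s (Y_i)|) + E |sum_i s (Y_i)|].
The variables [s (Y_i)] are uncorrelated, again by reflection, so the last term
is at most the square root of [sum_i E (s (Y_i)^2)].

The first inequality is the case [K = 1/2], in which the last two terms are at
most [B / 2 + sqrt (B / 2)] with [B = sum_i E |Y_i|^3]; since the distance never
exceeds 1, this may be replaced by [(8 / pi)^(1/4) sqrt B]. The second one is the
case where [K] is the product of [a] and the largest [|theta_i|]: then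
[Y_i^2 = |s (Y_i)|] almost surely, the last term is at most [K], and
[K <= n K^3]. *)

Set Implicit Arguments.
Unset Strict Implicit.
Unset Printing Implicit Defensive.
Import Order.TTheory GRing.Theory Num.Theory.
Import numFieldNormedType.Exports.

Local Open Scope classical_set_scope.
Local Open Scope ring_scope.

(** * The normal law and its Mills ratios *)

Section normal_law.
Context {R : realType}.
Implicit Types (t u v w x : R).

Lemma increment_ge (f df : R -> R) (m a b : R) : a <= b ->
  (forall x, a <= x <= b -> is_derive x 1 f (df x)) ->
  (forall x, a <= x <= b -> m <= df x) ->
  m * (b - a) <= f b - f a.
Proof.
move=> ab Df mdf.
have Dfo x : x \in `]a, b[ -> is_derive x 1 f (df x).
  by rewrite in_itv/= => /andP[ax xb]; apply: Df; rewrite !ltW.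
have cf : {within `[a, b], continuous f}.
  apply: continuous_in_subspaceT => x; rewrite inE/= in_itv/= => xab.
  by apply/differentiable_continuous/derivable1_diffP; have [] := Df _ xab.
have [c] := MVT_segment ab Dfo cf.
by rewrite in_itv/= => /mdf mc ->; rewrite ler_wpM2r ?subr_ge0.
Qed.

Lemma increment_le (f df : R -> R) (M a b : R) : a <= b ->
  (forall x, a <= x <= b -> is_derive x 1 f (df x)) ->
  (forall x, a <= x <= b -> df x <= M) ->
  f b - f a <= M * (b - a).
Proof.
move=> ab Df dfM; rewrite -lerN2 opprB -mulNr.
have -> : f a - f b = (- f) b - (- f) a.
  by rewrite -[(- f) b]/(- f b) -[(- f) a]/(- f a) opprK addrC.
apply: (@increment_ge _ (fun x => - df x)) => // x xab; last by rewrite lerN2 dfM.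
by apply: is_deriveN; exact: Df.
Qed.

Local Notation phi := (normal_pdf 0 1 : R -> R).

Definition Phi t : R := fine (std_normal_cdf t).

Lemma phiE x : phi x = normal_peak 1 * expR (- (x ^+ 2 / 2)).
Proof.
rewrite normal_pdfE ?oner_neq0//; congr (_ * expR _).
by rewrite subr0 expr1n mulNr.
Qed.

Lemma phi_gt0 x : 0 < phi x.
Proof. by rewrite phiE mulr_gt0 ?expR_gt0// normal_peak_gt0 ?oner_neq0. Qed.

Lemma is_derive_phi x : is_derive x 1 phi (- x * phi x).
Proof.
have -> : phi = fun x => normal_peak 1 * expR (- (x ^+ 2 / 2)).
  by apply/funext => y; exact: phiE.
apply: is_derive_eq.
by rewrite /GRing.scale/=; field.
Qed.

Lemma std_normal_cdfE t : std_normal_cdf t = (Phi t)%:E.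
Proof. by rewrite /Phi fineK// fin_num_measure. Qed.

Lemma Phi_ge0 t : 0 <= Phi t.
Proof. by rewrite fine_ge0. Qed.

Lemma Phi_le1 t : Phi t <= 1.
Proof. by rewrite -lee_fin -std_normal_cdfE probability_le1. Qed.

Lemma is_derive_Phi x : is_derive x 1 Phi (phi x).
Proof.
have ip : lebesgue_measure.-integrable `]-oo, x + 1] (EFin \o phi).
  by apply: integrableS (integrable_normal_pdf 0 1).
have xx : x < x + 1 by rewrite ltrDl.
have := @continuous_FTC1 R phi -oo%O x (x + 1) xx ip.
move=> /(_ (ltNyr _)) [|d1 d2].
  by apply: continuous_normal_pdf; exact: oner_neq0.
by split => //; rewrite -derive1E.
Qed.

Lemma Phi_cvg : Phi @ -oo --> (0 : R) /\ Phi @ +oo --> (1 : R).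
Proof.
pose N : probability (measurableTypeR R) R := normal_prob 0 1.
pose X : {mfun measurableTypeR R >-> R} :=
  HB.pack (idfun : measurableTypeR R -> R)
    (@isMeasurableFun.Build _ _ _ _ (idfun : measurableTypeR R -> R)
      (@measurable_id _ _ setT)).
have cdfE : cdf (X : {RV N >-> R}) = EFin \o Phi.
  by apply/funext => x /=; rewrite -std_normal_cdfE.
split.
  have := cvg_cdfNy0 (X : {RV N >-> R}).
  by rewrite cdfE => /fine_cvg.
have := cvg_cdfy1 (X : {RV N >-> R}).
by rewrite cdfE => /fine_cvg.
Qed.

Lemma is_derive_div (f g : R -> R) (a b x : R) :
  is_derive x 1 f a -> is_derive x 1 g b -> g x != 0 ->
  is_derive x 1 (fun y => f y / g y) ((a * g x - f x * b) / g x ^+ 2).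
Proof.
move=> df dg gx0; have dgV := is_deriveV gx0 dg.
by apply: is_derive_eq; rewrite /GRing.scale/=; field.
Qed.

End normal_law.

Section stein_equation.
Context {R : realType}.
Implicit Types (t u v w x y : R).

Local Notation phi := (normal_pdf 0 1 : R -> R).

(* [G] stands both for [Phi] and for the reflected upper tail
   [fun x => 1 - Phi (- x)], which yields the estimates at +oo from those
   at -oo. *)
Section mills.
Variable G : R -> R.
Hypothesis G_ge0 : forall x, 0 <= G x.
Hypothesis dG : forall x, is_derive x 1 G (phi x).
Hypothesis G_Ny : G @ -oo --> (0 : R).

(** For negative [x] the difference of the two sides of [G <= - phi / x] has the
derivative [phi / x ^+ 2 >= 0] and is bounded below by [- G], which vanishes
at -oo. *)
Lemma mills_le x : - phi x <= x * G x.
Proof.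
have [x0|x0] := leP 0 x.
  by rewrite (@le_trans _ _ 0)// ?oppr_le0 ?mulr_ge0// ltW ?phi_gt0.
pose D (y : R) : R := - (phi y / y) - G y.
have dD (y : R) : y < 0 -> is_derive y 1 D (phi y / y ^+ 2).
  move=> y0; have yn0 : y != 0 by rewrite lt_eqF.
  have := is_derive_div (is_derive_phi y) (is_derive_id y 1) yn0.
  move=> ?; have ? := dG y.
  by apply: is_derive_eq; field.
have Dx0 : 0 <= D x.
  rewrite leNgt; apply/negP => Dx; have mDx : 0 < - D x by rewrite oppr_gt0.
  have /cvgrPdist_lt/(_ _ mDx) GN := G_Ny.
  have : \forall y \near -oo, y < x by apply: nbhs_ninfty_lt; exact: num_real.
  move=> /(filterI GN)/(@filter_ex _ _ _)[y /= []].
  rewrite sub0r normrN ger0_norm// => Gy yx.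
  have := @increment_ge _ D (fun y => phi y / y ^+ 2) 0 y x (ltW yx).
  rewrite mul0r subr_ge0 => H; have : D y <= D x.
    apply: H => z /andP[_ zx]; first by apply: dD; rewrite (le_lt_trans zx).
    by rewrite mulr_ge0 ?invr_ge0 ?sqr_ge0// ltW ?phi_gt0.
  have y0 : y < 0 by exact: lt_trans yx x0.
  have : 0 <= - (phi y / y).
    by rewrite -mulrN -invrN mulr_ge0 ?invr_ge0 ?oppr_ge0 ?(ltW y0)// ltW ?phi_gt0.
  rewrite {1}/D; lra.
have : 0 <= D x * (- x) by rewrite mulr_ge0// oppr_ge0 ltW.
rewrite /D; have -> : (- (phi x / x) - G x) * - x = phi x + x * G x.
  by field; rewrite lt_eqF.
lra.
Qed.

(** The difference [G + x phi / (1 + x ^+ 2)] has the derivative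
[2 phi / (1 + x ^+ 2) ^+ 2 >= 0], and it is at least [x phi / (1 + x ^+ 2)],
which vanishes at -oo. *)
Lemma mills_ge x : 0 <= (1 + x ^+ 2) * G x + x * phi x.
Proof.
have q0 y : 0 < 1 + y ^+ 2 by rewrite ltr_pwDl// sqr_ge0.
pose D y := G y + y * phi y / (1 + y ^+ 2).
have dD y : is_derive y 1 D (2 * phi y / (1 + y ^+ 2) ^+ 2).
  have ? := is_derive_phi y; have ? := dG y.
  have h : is_derive y 1 (fun z : R => z * phi z) (phi y - y ^+ 2 * phi y).
    by apply: is_derive_eq; rewrite /GRing.scale/=; ring.
  have h' : is_derive y 1 (fun z : R => 1 + z ^+ 2) (2 * y).
    by apply: is_derive_eq; rewrite /GRing.scale/=; ring.
  have := is_derive_div h h' (lt0r_neq0 (q0 y)) => ?.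
  by apply: is_derive_eq; field; rewrite lt0r_neq0.
suff Dx0 : 0 <= D x.
  have := mulr_ge0 Dx0 (ltW (q0 x)); rewrite /D.
  have -> // : (G x + x * phi x / (1 + x ^+ 2)) * (1 + x ^+ 2) =
    (1 + x ^+ 2) * G x + x * phi x.
  by field; rewrite lt0r_neq0.
rewrite leNgt; apply/negP => Dx.
(* D y >= y c / (1 + y ^+ 2) for negative y; the witness lies so far to the
   left that this lower bound exceeds D x < 0 *)
pose c : R := normal_peak 1.
have c0 : 0 < c by rewrite normal_peak_gt0 ?oner_neq0.
pose y := Num.min x (Num.min (- 1) (2 * c / D x)).
have yx : y <= x by rewrite ge_min lexx.
have y1 : y <= - 1 by rewrite !ge_min lexx orbT.
have yD : y <= 2 * c / D x by rewrite !ge_min lexx !orbT.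
have := @increment_ge _ D (fun y => 2 * phi y / (1 + y ^+ 2) ^+ 2) 0 y x yx.
rewrite mul0r subr_ge0 => H; have : D y <= D x.
  apply: H => // z _.
  by rewrite mulr_ge0 ?invr_ge0 ?sqr_ge0// mulr_ge0// ltW ?phi_gt0.
have : y * c / (1 + y ^+ 2) <= D y.
  rewrite /D ler_wpDl// ler_pM2r ?invr_gt0// ler_wnM2l ?(le_trans y1) ?lerN10//.
  by apply: normal_pdf_ub; rewrite oner_neq0.
move=> H1 /(le_trans H1); rewrite leNgt => /negP; apply.
rewrite ltr_pdivlMr//.
have : D x * (2 * c / D x) <= D x * y by rewrite ler_nM2l.
rewrite mulrC divfK ?lt_eqF// => H2.
nra.
Qed.

(** The ratio [G / phi] solves the Stein equation with constant right-hand side. *)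
Lemma is_derive_ratio x :
  is_derive x 1 (fun y => G y / phi y) (1 + x * (G x / phi x)).
Proof.
have p0 : phi x != 0 by rewrite lt0r_neq0// phi_gt0.
have := is_derive_div (dG x) (is_derive_phi x) p0 => ?.
by apply: is_derive_eq; field.
Qed.

Lemma mul_ratio_ge x : - 1 <= x * (G x / phi x).
Proof. by rewrite mulrA ler_pdivlMr ?phi_gt0// mulN1r mills_le. Qed.

(** The derivative is [((1 + x ^+ 2) G + x phi) / phi], whose numerator is that
of [mills_ge]. *)
Lemma mul_ratio_nondecreasing :
  {homo (fun x => x * (G x / phi x)) : x y / x <= y}.
Proof.
move=> x y xy; rewrite -subr_ge0.
rewrite -[leLHS](mul0r (y - x)).
refine (@increment_ge _ (fun x => x * (G x / phi x))
  (fun z => ((1 + z ^+ 2) * G z + z * phi z) / phi z) _ _ _ xy _ _) => z _.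
  have ? := is_derive_ratio z.
  apply: is_derive_eq; rewrite /GRing.scale/=; field.
  by rewrite lt0r_neq0// phi_gt0.
by rewrite divr_ge0 ?mills_ge// ltW// phi_gt0.
Qed.

End mills.

(** * The bounded solution of the Stein equation *)

Lemma phiN x : phi (- x) = phi x.
Proof. by rewrite !phiE sqrrN. Qed.

Let lower (x : R) : R := Phi x / phi x.
Let upper (x : R) : R := (1 - Phi x) / phi x.

Let lower_ge0 x : 0 <= lower x.
Proof. by rewrite divr_ge0 ?Phi_ge0// ltW// phi_gt0. Qed.

Let upper_ge0 x : 0 <= upper x.
Proof. by rewrite divr_ge0 ?subr_ge0 ?Phi_le1// ltW// phi_gt0. Qed.

Let is_derive_lower x : is_derive x 1 lower (1 + x * lower x).
Proof. exact/is_derive_ratio/is_derive_Phi. Qed.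

Let mul_lower_nd : {homo (fun x => x * lower x) : x y / x <= y}.
Proof.
exact: (mul_ratio_nondecreasing Phi_ge0 is_derive_Phi).
Qed.

Let mul_lower_ge x : - 1 <= x * lower x.
Proof. exact: (mul_ratio_ge Phi_ge0 is_derive_Phi Phi_cvg.1). Qed.

Let tail (x : R) : R := 1 - Phi (- x).

Let tail_ge0 x : 0 <= tail x. Proof. by rewrite subr_ge0 Phi_le1. Qed.

Let is_derive_tail x : is_derive x 1 tail (phi x).
Proof.
have h : is_derive x 1 (fun y : R => Phi (- y)) (- phi x).
  have ? := is_derive_Phi (- x).
  have ? := @is_derive1_comp R Phi -%R x _ _ (is_derive_Phi (- x)) (is_deriveNid x 1).
  by apply: is_derive_eq; rewrite phiN mulrN1.
by apply: is_derive_eq; ring.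
Qed.

Let tail_Ny : tail @ -oo --> (0 : R).
Proof.
rewrite -(subrr (1 : R)); apply: cvgB; first exact: cvg_cst.
by apply/cvgNy_compNP; under eq_fun do rewrite /= opprK; exact: Phi_cvg.2.
Qed.

Let mul_upperE x : x * upper x = - ((- x) * (tail (- x) / phi (- x))).
Proof. by rewrite /tail opprK phiN mulNr opprK. Qed.

Let is_derive_upper x : is_derive x 1 upper (- 1 + x * upper x).
Proof.
have p0 : phi x != 0 by rewrite lt0r_neq0// phi_gt0.
have ? := is_derive_Phi x.
have h : is_derive x 1 (fun y => 1 - Phi y) (- phi x).
  by apply: is_derive_eq; ring.
have := is_derive_div h (is_derive_phi x) p0 => ?.
by apply: is_derive_eq; rewrite /upper; field.
Qed.

Let mul_upper_nd : {homo (fun x => x * upper x) : x y / x <= y}.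
Proof.
move=> x y xy; rewrite !mul_upperE lerN2.
by apply: (mul_ratio_nondecreasing tail_ge0 is_derive_tail); rewrite lerN2.
Qed.

Let mul_upper_le x : x * upper x <= 1.
Proof.
rewrite mul_upperE lerNl.
exact: (mul_ratio_ge tail_ge0 is_derive_tail tail_Ny).
Qed.

Section solution.
Variable t : R.

Let T := Phi t.
Let T0 : 0 <= T := Phi_ge0 t.
Let T1 : 0 <= 1 - T. Proof. by rewrite subr_ge0 Phi_le1. Qed.
Let ind w : R := (w <= t)%R%:R.
(* (1 - T) lower and T upper are the solutions of the Stein equation that stay
   bounded at -oo and at +oo; they agree at t *)
Let f w := if w <= t then (1 - T) * lower w else T * upper w.
Let g w := w * f w.

Let f_left w : w <= t -> f w = (1 - T) * lower w.
Proof. by rewrite /f => ->. Qed.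

Let f_right w : t <= w -> f w = T * upper w.
Proof.
rewrite le_eqVlt /f => /predU1P[<-|tw]; last by rewrite leNgt tw.
by rewrite lexx /lower /upper -/T mulrCA.
Qed.

Let g_left w : w <= t -> g w = (1 - T) * (w * lower w).
Proof. by move=> wt; rewrite /g f_left// mulrCA. Qed.

Let g_right w : t <= w -> g w = T * (w * upper w).
Proof. by move=> wt; rewrite /g f_right// mulrCA. Qed.

Let g_nd : {homo g : x y / x <= y}.
Proof.
have gl x y : x <= y -> y <= t -> g x <= g y.
  move=> xy yt; rewrite !g_left// ?(le_trans xy)//.
  by rewrite ler_wpM2l// mul_lower_nd.
have gr x y : x <= y -> t <= x -> g x <= g y.
  move=> xy tx; rewrite !g_right// ?(le_trans tx)//.
  by rewrite ler_wpM2l// mul_upper_nd.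
move=> x y xy; have [yt|/ltW ty] := leP y t; first exact: gl.
have [xt|/ltW tx] := leP x t; last exact: gr.
exact: le_trans (gl _ _ xt (lexx t)) (gr _ _ ty (lexx t)).
Qed.

Let g_ge w : T - 1 <= g w.
Proof.
have gl x : x <= t -> T - 1 <= g x.
  move=> xt; rewrite g_left// -opprB -mulrN1 ler_wpM2l//; exact: mul_lower_ge.
have [wt|/ltW tw] := leP w t; first exact: gl.
exact: le_trans (gl _ (lexx t)) (g_nd tw).
Qed.

Let g_le w : g w <= T.
Proof.
have gr x : t <= x -> g x <= T.
  by move=> tx; rewrite g_right// -[leRHS]mulr1 ler_wpM2l.
have [/ltW tw|wt] := ltP t w; first exact: gr.
exact: le_trans (g_nd wt) (gr _ (lexx t)).
Qed.

Let f_ge0 w : 0 <= f w.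
Proof. by rewrite /f; case: ifP => _; rewrite mulr_ge0. Qed.

(* f' = g + 1 - T on the left of t and f' = g - T on the right: the monotonicity
   of g encloses the slopes of f between the values of f' at the endpoints *)
Let slope_left u v : u <= v -> v <= t ->
  (v - u) * (g u + 1 - T) <= f v - f u <= (v - u) * (g v + 1 - T).
Proof.
move=> uv vt; have ut := le_trans uv vt.
rewrite !f_left// -mulrBr.
have df (x : R) : u <= x <= v -> is_derive x 1 lower (1 + x * lower x) by [].
have lo := @increment_ge _ lower (fun x => 1 + x * lower x) (1 + u * lower u)
  u v uv df.
have up := @increment_le _ lower (fun x => 1 + x * lower x) (1 + v * lower v)
  u v uv df.
rewrite !g_left//; apply/andP; split.
  have -> : (v - u) * ((1 - T) * (u * lower u) + 1 - T) =
      (1 - T) * ((1 + u * lower u) * (v - u)) by ring.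
  rewrite ler_wpM2l//; apply: lo => x /andP[ux _].
  by rewrite lerD2l mul_lower_nd.
have -> : (v - u) * ((1 - T) * (v * lower v) + 1 - T) =
    (1 - T) * ((1 + v * lower v) * (v - u)) by ring.
rewrite ler_wpM2l//; apply: up => x /andP[_ xv].
by rewrite lerD2l mul_lower_nd.
Qed.

Let slope_right u v : u <= v -> t <= u ->
  (v - u) * (g u - T) <= f v - f u <= (v - u) * (g v - T).
Proof.
move=> uv tu; have tv := le_trans tu uv.
rewrite !f_right// -mulrBr.
have df (x : R) : u <= x <= v -> is_derive x 1 upper (- 1 + x * upper x) by [].
have lo := @increment_ge _ upper (fun x => - 1 + x * upper x) (- 1 + u * upper u)
  u v uv df.
have up := @increment_le _ upper (fun x => - 1 + x * upper x) (- 1 + v * upper v)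
  u v uv df.
rewrite !g_right//; apply/andP; split.
  have -> : (v - u) * (T * (u * upper u) - T) =
      T * ((- 1 + u * upper u) * (v - u)) by ring.
  rewrite ler_wpM2l//; apply: lo => x /andP[ux _].
  by rewrite lerD2l mul_upper_nd.
have -> : (v - u) * (T * (v * upper v) - T) =
    T * ((- 1 + v * upper v) * (v - u)) by ring.
rewrite ler_wpM2l//; apply: up => x /andP[_ xv].
by rewrite lerD2l mul_upper_nd.
Qed.

(* f increases up to t and decreases afterwards *)
Let f_le w : f w <= f t.
Proof.
rewrite -subr_ge0; have [wt|/ltW tw] := leP w t.
  have /andP[+ _] := slope_left wt (lexx t); apply: le_trans.
  by rewrite mulr_ge0 ?subr_ge0//; have := g_ge w; lra.
have /andP[_ +] := slope_right tw (lexx t).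
rewrite -lerN2 opprB; apply: le_trans.
by rewrite -mulrN mulr_ge0 ?subr_ge0// opprB subr_ge0.
Qed.

Let slope u v : u <= v ->
  (v - u) * (g u + ind v - T) <= f v - f u <= (v - u) * (g v + ind u - T).
Proof.
move=> uv; rewrite /ind; have [vt|tv] := leP v t.
  by rewrite (le_trans uv vt); exact: slope_left.
have [ut|tu] := leP u t; last first.
  by rewrite !addr0; apply: slope_right => //; exact: ltW.
rewrite !(mulr0n, mulr1n).
have /andP[l1 l2] := slope_left ut (lexx t).
have /andP[r1 r2] := slope_right (ltW tv) (lexx t).
have gut := g_nd ut; have gtv := g_nd (ltW tv).
have tu0 : 0 <= t - u by rewrite subr_ge0.
have vt0 : 0 <= v - t by rewrite subr_ge0 ltW.
have -> : v - u = (v - t) + (t - u) by ring.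
have -> : f v - f u = (f v - f t) + (f t - f u) by ring.
rewrite !(mulrDl (v - t)); apply/andP; split; apply: lerD.
- by apply: le_trans _ r1; rewrite ler_wpM2l//; lra.
- by apply: le_trans _ l1; rewrite ler_wpM2l//; lra.
- by apply: le_trans r2 _; rewrite ler_wpM2l//; lra.
- by apply: le_trans l2 _; rewrite ler_wpM2l//; lra.
Qed.

(* h is f' (at t, the left derivative), and p is g - ind shifted so that its
   range is centred at 0 *)
Let h w := g w + ind w - T.
Let p w := g w - ind w + (1 - T).

Let ind_ni u v : u <= v -> ind v <= ind u.
Proof.
move=> uv; rewrite /ind ler_nat; have [vt|//] := leP v t.
by rewrite (le_trans uv vt).
Qed.

Let p_nd : {homo p : x y / x <= y}.
Proof.
by move=> x y xy; rewrite lerD2r; apply: lerB; [exact: g_nd|exact: ind_ni].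
Qed.

Let trapezoid u v :
  `|(v - u) * (h u + h v) - 2 * (f v - f u)| <= `|v - u| * `|p v - p u|.
Proof.
wlog uv : u v / u <= v => [th|].
  have [|/ltW/th vu] := leP u v; first exact: th.
  rewrite (distrC v u) (distrC (p v)); apply: le_trans vu.
  by rewrite distrC le_eqVlt; apply/orP; left; apply/eqP; congr `|_|; ring.
have /andP[l r] := slope uv.
have := p_nd uv; rewrite -subr_ge0 => puv.
rewrite -normrM [leRHS]ger0_norm ?mulr_ge0 ?subr_ge0 ?p_nd//.
by rewrite ler_norml /h /p; apply/andP; split; lra.
Qed.

(** Here [h] is the derivative of [f] away from [t]. It is the sum of a
nondecreasing and of a nonincreasing function, hence of bounded variation, and
[p] measures this variation: the last clause bounds the error of the trapezoid
rule for the integral of [h] by the increment of a single nondecreasing function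
bounded by 1. *)
Lemma stein_solution : exists (f h p : R -> R),
  [/\ measurable_fun setT f, exists C, forall w, `|f w| <= C,
      measurable_fun setT h & forall w, `|h w| <= 1] /\
  [/\ {homo p : x y / x <= y}, forall w, `|p w| <= 1,
      forall w, h w - w * f w = (w <= t)%R%:R - Phi t &
      forall u v, `|(v - u) * (h u + h v) - 2 * (f v - f u)| <=
        `|v - u| * `|p v - p u|].
Proof.
have mg : measurable_fun setT g.
  by apply: nondecreasing_measurable => //; exact: g_nd.
have mind : measurable_fun setT ind.
  rewrite (_ : ind = \1_`]-oo, t]) ?measurable_indic//.
  apply/funext => w; rewrite /ind indicE; congr ((nat_of_bool _)%:R).
  by apply/idP/idP; rewrite inE/= in_itv.
have mf : measurable_fun setT f.
  have cts (k dk : R -> R) : (forall x, is_derive x 1 k (dk x)) ->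
      measurable_fun setT k.
    move=> Dk; apply: continuous_measurable_fun => x.
    by apply/differentiable_continuous/derivable1_diffP; have [] := Dk x.
  rewrite (_ : f = ind * ((1 - T) \*o lower) + (cst 1 - ind) * (T \*o upper)).
    apply: measurable_funD; apply: measurable_funM => //.
    - by apply: measurable_funM => //; exact: cts is_derive_lower.
    - exact: measurable_funB.
    - by apply: measurable_funM => //; exact: cts is_derive_upper.
  apply/funext => w; rewrite /f /ind !fctE/=; case: (w <= t);
    rewrite !(mulr0n, mulr1n); ring.
exists f, h, p; split; split=> //.
- exists (f t) => w; rewrite ger0_norm//; exact: f_le.
- by apply: measurable_funB => //; exact: measurable_funD.
- move=> w; have := g_le w; have := g_ge w; rewrite ler_norml /h /ind.
  case: (w <= t); rewrite !(mulr0n, mulr1n) => ? ?; apply/andP; split; lra.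
- move=> w; have := g_le w; have := g_ge w; rewrite ler_norml /p /ind.
  case: (w <= t); rewrite !(mulr0n, mulr1n) => ? ?; apply/andP; split; lra.
- by move=> w; rewrite /h /g /ind -/T; ring.
Qed.

End solution.

End stein_equation.

(** * Expectations of real random variables *)

Section expectation.
Context {d : measure_display} {T : measurableType d} {R : realType}.
Variable P : probability T R.
Implicit Types (F G : T -> R).

Local Notation Ex F := (\int[P]_w (F w)).
Local Notation L1 F := (P.-integrable setT (EFin \o F)).

Lemma L1_le F G : measurable_fun setT F -> L1 G ->
  (forall w, `|F w| <= G w) -> L1 F.
Proof.
move=> mF iG FG; apply: le_integrable iG => //; first exact/measurable_EFinP.
by move=> w _ /=; rewrite lee_fin (le_trans (FG w))// ler_norm.
Qed.

Lemma L1_measurable F : L1 F -> measurable_fun setT F.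
Proof. by move=> /integrableP[/measurable_EFinP]. Qed.

Lemma L1_cst c : L1 (fun=> c).
Proof. exact: finite_measure_integrable_cst. Qed.

Lemma Ex_cst c : Ex (fun=> c) = c.
Proof.
rewrite Rintegral_cst// -[RHS]mulr1; congr (_ * _).
exact: (congr1 fine (probability_setT P)).
Qed.

Lemma L1D F G : L1 F -> L1 G -> L1 (fun w => F w + G w).
Proof. by move=> iF iG; exact: (integrableD _ iF iG). Qed.

Lemma L1B F G : L1 F -> L1 G -> L1 (fun w => F w - G w).
Proof. by move=> iF iG; exact: (integrableB _ iF iG). Qed.

Lemma L1Z c F : L1 F -> L1 (fun w => c * F w).
Proof. by move=> iF; exact: (integrableZl _ c iF). Qed.

Lemma L1_norm F : L1 F -> L1 (fun w => `|F w|).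
Proof. exact: integrable_norm. Qed.

Lemma L1_sum (I : Type) (r : seq I) (A : pred I) (F : I -> T -> R) :
  (forall i, A i -> L1 (F i)) -> L1 (fun w => \sum_(i <- r | A i) F i w).
Proof.
move=> iF; have := @integrable_sum _ _ _ P setT measurableT _ r A
  (fun i w => (F i w)%:E) iF.
by apply: eq_integrable => //= w _; rewrite sumEFin.
Qed.

Lemma Ex_sum (I : Type) (r : seq I) (F : I -> T -> R) :
  (forall i, L1 (F i)) ->
  Ex (fun w => \sum_(i <- r) F i w) = \sum_(i <- r) Ex (F i).
Proof.
move=> iF; elim: r => [|i r IH].
  by under eq_Rintegral do rewrite big_nil; rewrite Rintegral_cst// mul0r big_nil.
under eq_Rintegral do rewrite big_cons.
by rewrite big_cons RintegralD// ?IH//; exact: L1_sum.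
Qed.

Lemma Ex_EFin F : L1 F -> (\int[P]_w (F w)%:E)%E = (Ex F)%:E.
Proof. by move=> iF; rewrite fineK// integrable_fin_num. Qed.

Lemma L1_ge0 F : measurable_fun setT F -> (forall w, 0 <= F w) ->
  (\int[P]_w (F w)%:E < +oo)%E -> L1 F.
Proof.
move=> mF F0 Foo; apply/integrableP; split; first exact/measurable_EFinP.
by under eq_integral do rewrite /= ger0_norm//.
Qed.

Lemma L1M F G : measurable_fun setT F -> measurable_fun setT G ->
  L1 (fun w => F w ^+ 2) -> L1 (fun w => G w ^+ 2) -> L1 (fun w => F w * G w).
Proof.
move=> mF mG iF iG; apply: L1_le (L1D iF iG) _; first exact: measurable_funM.
move=> w; rewrite ler_norml; have := sqr_ge0 (F w + G w).
have := sqr_ge0 (F w - G w); rewrite !expr2 => ? ?; apply/andP; split; nra.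
Qed.

Lemma L1_of_sqr F : measurable_fun setT F -> L1 (fun w => F w ^+ 2) -> L1 F.
Proof.
move=> mF iF; apply: (eq_integrable _ (EFin \o (fun w => F w * 1))) => //.
  by move=> w _ /=; rewrite mulr1.
apply: L1M => //; apply: (eq_integrable _ (EFin \o (fun=> 1))) => //.
  by move=> w _ /=; rewrite expr1n.
exact: L1_cst.
Qed.

(** The variance of [`|F|] is nonnegative. *)
Lemma Ex_norm_le_sqrt F : measurable_fun setT F -> L1 (fun w => F w ^+ 2) ->
  Ex (fun w => `|F w|) <= Num.sqrt (Ex (fun w => F w ^+ 2)).
Proof.
move=> mF iF2; have iF := L1_norm (L1_of_sqr mF iF2).
set m := Ex (fun w => `|F w|).
have m0 : 0 <= m by apply: Rintegral_ge0.
rewrite -(ger0_norm m0) -sqrtr_sqr; apply: ler_wsqrtr.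
have iG : L1 (fun w => F w ^+ 2 - (2 * m) * `|F w|) by exact: L1B (L1Z _ _).
have : 0 <= Ex (fun w => F w ^+ 2 - (2 * m) * `|F w| + m ^+ 2).
  apply: Rintegral_ge0 => w _; rewrite -(real_normK (num_real (F w))).
  have -> : `|F w| ^+ 2 - 2 * m * `|F w| + m ^+ 2 = (`|F w| - m) ^+ 2 by ring.
  exact: sqr_ge0.
rewrite RintegralD//; last exact: L1_cst.
rewrite RintegralB//; last exact: L1Z.
rewrite RintegralZl// Ex_cst -/m; nra.
Qed.

Lemma Ex_ae_eq F G : measurable_fun setT F -> measurable_fun setT G ->
  {ae P, forall w, F w = G w} -> Ex F = Ex G.
Proof.
move=> mF mG FG; rewrite /Rintegral; congr fine.
apply: ae_eq_integral => //; [exact/measurable_EFinP|exact/measurable_EFinP|].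
by apply: filterS FG => w FG _ /=; rewrite FG.
Qed.

End expectation.

(** * Invariance under reflections *)

Section reflections.
Context {d : measure_display} {T : measurableType d} {R : realType}.
Context {P : probability T R} {n : nat}.
Variable X : {RV P >-> n.-tuple R}.
Variable theta : n.-tuple R.
Hypothesis symX : unconditional X.

Local Notation Ex F := (\int[P]_w (F w)).
Local Notation L1 F := (P.-integrable setT (EFin \o F)).

Definition reflect_at (i : 'I_n) : n.-tuple R -> n.-tuple R :=
  sign_flip (fun j => j == i).

Lemma measurable_sign_flip (e : 'I_n -> bool) :
  measurable_fun setT (@sign_flip R n e).
Proof.
apply/measurable_fun_tnthP => i.
rewrite (_ : _ \o _ = fun x : n.-tuple R => (-1) ^+ e i * tnth x i).
  by apply: measurable_funM => //; exact: measurable_tnth.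
by apply/funext => x /=; rewrite tnth_mktuple.
Qed.

Lemma ge0_sign_flip (e : 'I_n -> bool) (F : n.-tuple R -> \bar R) :
  measurable_fun setT F -> (forall x, 0 <= F x)%E ->
  (\int[P]_w F (sign_flip e (X w)) = \int[P]_w F (X w))%E.
Proof.
move=> mF F0.
have mX : measurable_fun setT X by [].
have mfX := measurableT_comp (measurable_sign_flip e) mX.
have := ge0_integral_pushforward mX P measurableT mF (fun x _ => F0 x).
have := ge0_integral_pushforward mfX P measurableT mF (fun x _ => F0 x).
rewrite !preimage_setT => <- <-.
by apply: eq_measure_integral => A mA _; exact: symX.
Qed.

Lemma L1_sign_flip (e : 'I_n -> bool) (F : n.-tuple R -> R) :
  measurable_fun setT F ->
  L1 (fun w => F (X w)) -> L1 (fun w => F (sign_flip e (X w))).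
Proof.
move=> mF /integrableP[_ iF]; apply/integrableP; split.
  apply/measurable_EFinP; apply: measurableT_comp => //.
  by apply: measurableT_comp => //; exact: measurable_sign_flip.
rewrite (@ge0_sign_flip e (fun x => `|F x|%:E))//.
by apply/measurable_EFinP; exact: measurableT_comp.
Qed.

Lemma Ex_sign_flip (e : 'I_n -> bool) (F : n.-tuple R -> R) :
  measurable_fun setT F -> L1 (fun w => F (X w)) ->
  Ex (fun w => F (sign_flip e (X w))) = Ex (fun w => F (X w)).
Proof.
move=> mF iF; rewrite /Rintegral; congr fine.
have mX : measurable_fun setT X by [].
have mfX := measurableT_comp (measurable_sign_flip e) mX.
have mEF : measurable_fun setT (EFin \o F) by exact/measurable_EFinP.
have ifF := L1_sign_flip e mF iF.
have := integral_pushforward mX mEF iF measurableT.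
have := integral_pushforward mfX mEF ifF measurableT.
rewrite !preimage_setT => <- <-.
by apply: eq_measure_integral => A mA _; exact: symX.
Qed.

Definition summand (i : 'I_n) (x : n.-tuple R) : R := tnth x i * tnth theta i.

Lemma summand_reflect i j x :
  summand j (reflect_at i x) = if j == i then - summand j x else summand j x.
Proof.
by rewrite /summand tnth_mktuple; case: eqP => _; rewrite ?expr1 ?expr0; ring.
Qed.

Lemma dot_reflect i x : dot (reflect_at i x) theta = dot x theta - 2 * summand i x.
Proof.
rewrite /dot (bigD1 i)//= [in RHS](bigD1 i)//=.
rewrite -[X in X + _]/(summand i (reflect_at i x)) summand_reflect eqxx.
rewrite -[X in X + _ - _]/(summand i x).
rewrite (eq_bigr (fun j => summand j x)) => [|j ji]; last first.
  by rewrite -/(summand j (reflect_at i x)) summand_reflect (negbTE ji).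
by rewrite /summand; ring.
Qed.

Lemma measurable_summand i : measurable_fun setT (summand i).
Proof. by apply: measurable_funM => //; exact: measurable_tnth. Qed.

Lemma measurable_dot : measurable_fun setT (fun x : n.-tuple R => dot x theta).
Proof. by apply: measurable_sum => i; exact: measurable_summand. Qed.

(** The form in which unconditionality is used: [(- Y_i, W - 2 Y_i)] has the same
joint distribution as [(Y_i, W)], where [Y_i] is the [i]-th summand of [W]. *)
Lemma Ex_reflect (i : 'I_n) (k : R -> R -> R) :
  measurable_fun setT (fun z : R * R => k z.1 z.2) ->
  L1 (fun w => k (summand i (X w)) (dot (X w) theta)) ->
  Ex (fun w => k (- summand i (X w)) (dot (X w) theta - 2 * summand i (X w))) =
  Ex (fun w => k (summand i (X w)) (dot (X w) theta)).
Proof.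
move=> mk ik.
rewrite -(@Ex_sign_flip (fun j => j == i)
  (fun x => k (summand i x) (dot x theta))) //.
  apply: eq_Rintegral => w _.
  by rewrite -/(reflect_at i _) summand_reflect eqxx dot_reflect.
have := measurableT_comp mk (measurable_fun_pair (measurable_summand i) measurable_dot).
exact.
Qed.

Lemma measurable_component i : measurable_fun setT (component X i).
Proof.
have mX : measurable_fun setT X by [].
exact: measurableT_comp (measurable_tnth i) mX.
Qed.

Lemma measurable_summandX i : measurable_fun setT (fun w => summand i (X w)).
Proof.
have mX : measurable_fun setT X by [].
exact: measurableT_comp (measurable_summand i) mX.
Qed.

Lemma measurable_dotX : measurable_fun setT (fun w => dot (X w) theta).
Proof.
have mX : measurable_fun setT X by [].
exact: measurableT_comp measurable_dot mX.
Qed.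

End reflections.

(** * The bound by Stein's method *)

Section signed_square.
Context {R : realType}.
Variable K : R.
Hypothesis K0 : 0 <= K.
Implicit Types y w : R.

(** A truncation at level [K] of [y `|y|]. Being odd, it gives centred and
uncorrelated random variables when evaluated at the summands of [W]. *)
Definition signed_sqr y : R := y * Num.min `|y| K.

Lemma signed_sqrN y : signed_sqr (- y) = - signed_sqr y.
Proof. by rewrite /signed_sqr normrN mulNr. Qed.

Lemma norm_signed_sqr y : `|signed_sqr y| = `|y| * Num.min `|y| K.
Proof. by rewrite normrM [X in _ * X]ger0_norm// le_min normr_ge0. Qed.

Lemma norm_signed_sqr_le y : `|signed_sqr y| <= y ^+ 2.
Proof.
by rewrite norm_signed_sqr -real_normK ?num_real// expr2 ler_wpM2l// ge_min lexx.
Qed.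

Lemma measurable_signed_sqr : measurable_fun setT signed_sqr.
Proof.
apply: measurable_funM => //.
by apply: measurable_minr => //; exact: measurable_normr.
Qed.

(** As [p] is nondecreasing, its increment has the sign of [y], which turns the
absolute value into the product with [signed_sqr y]; the part of [y ^+ 2] that
the truncation removes is multiplied by an increment of at most 2. *)
Lemma sqr_variation_le (p : R -> R) y w :
  {homo p : u v / u <= v} -> (forall u, `|p u| <= 1) ->
  y ^+ 2 * `|p w - p (w - 2 * y)| <=
  signed_sqr y * (p w - p (w - 2 * y)) + 2 * (y ^+ 2 - `|signed_sqr y|).
Proof.
move=> p_nd p1; set D := p w - _.
have D2 : `|D| <= 2.
  by rewrite (le_trans (ler_normB _ _))// (le_trans (lerD (p1 _) (p1 _))).
have -> : signed_sqr y * D = `|signed_sqr y| * `|D|.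
  have m0 : 0 <= Num.min `|y| K by rewrite le_min normr_ge0.
  rewrite norm_signed_sqr /signed_sqr; have [y0|y0] := leP 0 y.
    have D0 : 0 <= D by rewrite subr_ge0; apply: p_nd; lra.
    by rewrite (ger0_norm y0) (ger0_norm D0).
  have D0 : D <= 0 by rewrite subr_le0; apply: p_nd; lra.
  by rewrite (ler0_norm D0) (ltr0_norm y0); ring.
have := norm_signed_sqr_le y; rewrite -subr_ge0; nra.
Qed.

End signed_square.

Lemma measurable_dot_le {d : measure_display} {T : measurableType d}
    {R : realType} {P : probability T R} {n : nat} (X : {RV P >-> n.-tuple R})
    (theta : n.-tuple R) t :
  measurable [set w | dot (X w) theta <= t].
Proof.
have := measurable_dotX X theta measurableT (measurable_itv `]-oo, t]); rewrite setTI.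
by congr measurable; apply/seteqP; split => w /=; rewrite in_itv.
Qed.

Section stein_bound.
Context {d : measure_display} {T : measurableType d} {R : realType}.
Context {P : probability T R} {n : nat}.
Variable X : {RV P >-> n.-tuple R}.
Variable theta : n.-tuple R.
Hypothesis symX : unconditional X.

Local Notation Ex F := (\int[P]_w (F w)).
Local Notation L1 F := (P.-integrable setT (EFin \o F)).
Local Notation Y i := (fun w => summand theta i (X w)).
Local Notation W := (fun w => dot (X w) theta).

Hypothesis iY2 : forall i, L1 (fun w => Y i w ^+ 2).

Let mY := measurable_summandX X theta.
Let mW := measurable_dotX X theta.

Variable K : R.
Hypothesis K0 : 0 <= K.

Let ms i : measurable_fun setT (fun w => signed_sqr K (Y i w)).
Proof. exact: measurableT_comp (measurable_signed_sqr K) (mY i). Qed.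

Let is_ i : L1 (fun w => signed_sqr K (Y i w)).
Proof. by apply: (L1_le (ms i) (iY2 i)) => w; exact: norm_signed_sqr_le. Qed.

Section with_solution.
Variables f h p : R -> R.
Hypotheses (mf : measurable_fun setT f) (mh : measurable_fun setT h)
  (p_nd : {homo p : x y / x <= y}) (h1 : forall w, `|h w| <= 1)
  (p1 : forall w, `|p w| <= 1).
Variable C : R.
Hypothesis f_le : forall w, `|f w| <= C.
Hypothesis trapezoid : forall u v,
  `|(v - u) * (h u + h v) - 2 * (f v - f u)| <= `|v - u| * `|p v - p u|.

Let mp : measurable_fun setT p.
Proof. exact: nondecreasing_measurable. Qed.

Let iYf i : L1 (fun w => Y i w * f (W w)).
Proof.
apply: (L1_le _ (L1Z C (L1_norm (L1_of_sqr (mY i) (iY2 i))))).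
  by apply: measurable_funM => //; exact: (measurableT_comp mf mW).
by move=> w; rewrite normrM mulrC ler_wpM2r.
Qed.

Let iYh i : L1 (fun w => Y i w ^+ 2 * h (W w)).
Proof.
apply: (L1_le _ (iY2 i)).
  apply: measurable_funM; last exact: (measurableT_comp mh mW).
  exact: measurable_funX.
by move=> w; rewrite normrM ger0_norm ?sqr_ge0// ler_piMr// sqr_ge0.
Qed.

Let isp i : L1 (fun w => signed_sqr K (Y i w) * p (W w)).
Proof.
apply: (L1_le _ (L1_norm (is_ i))).
  by apply: measurable_funM => //; exact: (measurableT_comp mp mW).
by move=> w; rewrite normrM ler_piMr.
Qed.

Let m1 : measurable_fun setT (fun z : R * R => z.1) := measurable_fst.
Let m2 : measurable_fun setT (fun z : R * R => z.2) := measurable_snd.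

Let reflect_Yf i : Ex (fun w => - Y i w * f (W w - 2 * Y i w)) =
  Ex (fun w => Y i w * f (W w)).
Proof.
apply: (Ex_reflect symX (k := fun y w => y * f w)); last exact: iYf.
by apply: measurable_funM => //; exact: (measurableT_comp mf m2).
Qed.

Let reflect_Yh i : Ex (fun w => (- Y i w) ^+ 2 * h (W w - 2 * Y i w)) =
  Ex (fun w => Y i w ^+ 2 * h (W w)).
Proof.
apply: (Ex_reflect symX (k := fun y w => y ^+ 2 * h w)); last exact: iYh.
apply: measurable_funM; first exact: measurable_funX.
exact: (measurableT_comp mh m2).
Qed.

Let reflect_sp i :
  Ex (fun w => signed_sqr K (- Y i w) * p (W w - 2 * Y i w)) =
  Ex (fun w => signed_sqr K (Y i w) * p (W w)).
Proof.
apply: (Ex_reflect symX (k := fun y w => signed_sqr K y * p w)); last exact: isp.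
apply: measurable_funM; last exact: (measurableT_comp mp m2).
exact: (measurableT_comp (measurable_signed_sqr K) m1).
Qed.

Let mWr i : measurable_fun setT (fun w => W w - 2 * Y i w).
Proof. by apply: measurable_funB => //; exact: measurable_funM. Qed.

Let iYf' i : L1 (fun w => Y i w * f (W w - 2 * Y i w)).
Proof.
apply: (L1_le _ (L1Z C (L1_norm (L1_of_sqr (mY i) (iY2 i))))).
  by apply: measurable_funM => //; exact: (measurableT_comp mf (mWr i)).
by move=> w; rewrite normrM mulrC ler_wpM2r.
Qed.

Let iYh' i : L1 (fun w => Y i w ^+ 2 * h (W w - 2 * Y i w)).
Proof.
apply: (L1_le _ (iY2 i)).
  apply: measurable_funM; last exact: (measurableT_comp mh (mWr i)).
  exact: measurable_funX.
by move=> w; rewrite normrM ger0_norm ?sqr_ge0// ler_piMr// sqr_ge0.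
Qed.

Let isp' i : L1 (fun w => signed_sqr K (Y i w) * p (W w - 2 * Y i w)).
Proof.
apply: (L1_le _ (L1_norm (is_ i))).
  by apply: measurable_funM => //; exact: (measurableT_comp mp (mWr i)).
by move=> w; rewrite normrM ler_piMr.
Qed.

Let ir i : L1 (fun w => Y i w ^+ 2 - `|signed_sqr K (Y i w)|).
Proof. exact: L1B (iY2 i) (L1_norm (is_ i)). Qed.

(** Averaging over the reflection of the [i]-th coordinate turns the left-hand
side into the expectation of a trapezoid error on the interval between [W] and
[W - 2 Y_i]. In the estimate of that error the increment of [p] is multiplied by
an odd function of [Y_i], so that the same reflection exchanges its two terms
and reduces their expectation to that of a value of [p] at [W]. *)
Lemma coordinate_bound i :
  `|Ex (fun w => Y i w ^+ 2 * h (W w)) - Ex (fun w => Y i w * f (W w))| <=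
  Ex (fun w => signed_sqr K (Y i w) * p (W w)) +
  Ex (fun w => Y i w ^+ 2 - `|signed_sqr K (Y i w)|).
Proof.
pose G w := (Y i w ^+ 2 * h (W w) + Y i w ^+ 2 * h (W w - 2 * Y i w)) -
  (Y i w * f (W w) - Y i w * f (W w - 2 * Y i w)).
pose H w := (signed_sqr K (Y i w) * p (W w) -
    signed_sqr K (Y i w) * p (W w - 2 * Y i w)) +
  2 * (Y i w ^+ 2 - `|signed_sqr K (Y i w)|).
have iGh := L1D (iYh i) (iYh' i).
have iGf := L1B (iYf i) (iYf' i).
have iHp := L1B (isp i) (isp' i).
have iHr := L1Z 2 (ir i).
have iG : L1 G := L1B iGh iGf.
have iH : L1 H := L1D iHp iHr.
have GH w : `|G w| <= H w.
  rewrite /H -mulrBr; apply: le_trans _ (sqr_variation_le K0 _ _ p_nd p1).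
  have := trapezoid (W w - 2 * Y i w) (W w).
  have -> : W w - (W w - 2 * Y i w) = 2 * Y i w by ring.
  move=> tr; have -> : G w = Y i w / 2 * (2 * Y i w * (h (W w - 2 * Y i w) +
      h (W w)) - 2 * (f (W w) - f (W w - 2 * Y i w))) by rewrite /G; field.
  rewrite normrM; apply: le_trans (ler_wpM2l (normr_ge0 _) tr) _.
  rewrite mulrA -normrM (_ : Y i w / 2 * (2 * Y i w) = Y i w ^+ 2).
    by rewrite ger0_norm ?sqr_ge0.
  by field.
have : `|Ex G| <= Ex H.
  apply: le_trans (le_normr_Rintegral measurableT iG) _.
  by apply: le_Rintegral => //; exact: L1_norm.
have EG : Ex G = 2 * (Ex (fun w => Y i w ^+ 2 * h (W w)) -
    Ex (fun w => Y i w * f (W w))).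
  rewrite RintegralB// RintegralD// RintegralB//.
  have -> : Ex (fun w => Y i w ^+ 2 * h (W w - 2 * Y i w)) =
      Ex (fun w => Y i w ^+ 2 * h (W w)).
    by rewrite -reflect_Yh; apply: eq_Rintegral => w _; rewrite sqrrN.
  have -> : Ex (fun w => Y i w * f (W w - 2 * Y i w)) =
      - Ex (fun w => Y i w * f (W w)).
    rewrite -reflect_Yf -mulN1r -RintegralZl//.
      by apply: eq_Rintegral => w _; ring.
    apply: eq_integrable (L1Z (-1) (iYf' i)) => // w _ /=.
    by rewrite mulN1r mulNr.
  ring.
have EH : Ex H = 2 * (Ex (fun w => signed_sqr K (Y i w) * p (W w)) +
    Ex (fun w => Y i w ^+ 2 - `|signed_sqr K (Y i w)|)).
  rewrite RintegralD// RintegralB// RintegralZl//.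
  have -> : Ex (fun w => signed_sqr K (Y i w) * p (W w - 2 * Y i w)) =
      - Ex (fun w => signed_sqr K (Y i w) * p (W w)).
    rewrite -reflect_sp -mulN1r -RintegralZl//.
      by apply: eq_Rintegral => w _; rewrite signed_sqrN; ring.
    apply: eq_integrable (L1Z (-1) (isp' i)) => // w _ /=.
    by rewrite signed_sqrN mulN1r mulNr.
  ring.
by rewrite EG EH normrM ger0_norm// ler_pM2l.
Qed.

(** Here [h - w f] is split as [h (1 - \sum_i Y_i ^+ 2)] plus the sum over the
coordinates of [Y_i ^+ 2 h - Y_i f]. *)
Lemma solution_bound :
  `|Ex (fun w => h (W w) - W w * f (W w))| <=
  Ex (fun w => `|1 - \sum_i Y i w ^+ 2|) +
  \sum_i Ex (fun w => Y i w ^+ 2 - `|signed_sqr K (Y i w)|) +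
  Ex (fun w => `|\sum_i signed_sqr K (Y i w)|).
Proof.
have iS : L1 (fun w => \sum_i Y i w ^+ 2) by exact: L1_sum.
have i1S := L1B (L1_cst P 1) iS.
have mhW : measurable_fun setT (fun w => h (W w)) := measurableT_comp mh mW.
have mpW : measurable_fun setT (fun w => p (W w)) := measurableT_comp mp mW.
have iA : L1 (fun w => h (W w) * (1 - \sum_i Y i w ^+ 2)).
  apply: (L1_le _ (L1_norm i1S)).
    by apply: measurable_funM => //; exact: L1_measurable i1S.
  by move=> w; rewrite normrM ler_piMl.
have iB i : L1 (fun w => Y i w ^+ 2 * h (W w) - Y i w * f (W w)).
  exact: L1B (iYh i) (iYf i).
have iBs := L1_sum (index_enum 'I_n) (fun i _ => iB i) (A := xpredT).
have -> : Ex (fun w => h (W w) - W w * f (W w)) =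
    Ex (fun w => h (W w) * (1 - \sum_i Y i w ^+ 2)) +
    \sum_i (Ex (fun w => Y i w ^+ 2 * h (W w)) - Ex (fun w => Y i w * f (W w))).
  under [in RHS]eq_bigr => i _ do rewrite -RintegralB//.
  rewrite -Ex_sum// -RintegralD//; apply: eq_Rintegral => w _.
  rewrite sumrB -!mulr_suml mulrBr mulr1 [h _ * _]mulrC.
  by rewrite -/(dot (X w) theta); ring.
have isps : L1 (fun w => \sum_i signed_sqr K (Y i w)) by exact: L1_sum.
have ispp : L1 (fun w => (\sum_i signed_sqr K (Y i w)) * p (W w)).
  apply: (L1_le _ (L1_norm isps)).
    by apply: measurable_funM => //; exact: L1_measurable isps.
  by move=> w; rewrite normrM ler_piMr.
apply: le_trans (ler_normD _ _) _; rewrite -addrA; apply: lerD.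
  apply: le_trans (le_normr_Rintegral measurableT iA) _.
  apply: le_Rintegral => //; [exact: L1_norm|exact: L1_norm|].
  by move=> w _; rewrite normrM ler_piMl.
apply: le_trans (ler_norm_sum _ _ _) _.
apply: le_trans (ler_sum _ (fun i _ => coordinate_bound i)) _.
rewrite big_split/= addrC lerD2l -Ex_sum//.
have -> : Ex (fun w => \sum_i signed_sqr K (Y i w) * p (W w)) =
    Ex (fun w => (\sum_i signed_sqr K (Y i w)) * p (W w)).
  by apply: eq_Rintegral => w _; rewrite mulr_suml.
apply: le_trans (ler_norm _) _.
apply: le_trans (le_normr_Rintegral measurableT ispp) _.
apply: le_Rintegral => //; [exact: L1_norm|exact: L1_norm|].
by move=> w _; rewrite normrM ler_piMr.
Qed.

End with_solution.
(** The three terms are the fluctuation of the conditional variance, the cost of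
truncating at [K], and the size of a sum of uncorrelated random variables. *)
Lemma stein_bound t :
  `|fine (P [set w | W w <= t]) - Phi t| <=
  Ex (fun w => `|1 - \sum_i Y i w ^+ 2|) +
  \sum_i Ex (fun w => Y i w ^+ 2 - `|signed_sqr K (Y i w)|) +
  Ex (fun w => `|\sum_i signed_sqr K (Y i w)|).
Proof.
have [f [h [p [[mf [C fC] mh h1] [p_nd p1 eqn trap]]]]] := @stein_solution R t.
have := solution_bound mf mh p_nd h1 p1 fC trap.
congr (`|_| <= _).
have mA := measurable_dot_le X theta t.
have iA : L1 (\1_[set w | W w <= t] : T -> R).
  exact: integrable_indic.
have -> : fine (P [set w | W w <= t]) = Ex (\1_[set w | W w <= t]).
  by rewrite /Rintegral integral_indic// setIT.
rewrite -[X in _ - X](Ex_cst P) -RintegralB//; last exact: L1_cst.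
apply: eq_Rintegral => w _; rewrite eqn indicE; congr (_%:R - _).
by congr nat_of_bool; apply/idP/idP; rewrite inE.
Qed.

End stein_bound.

(** * Moment estimates *)

Section moment_bounds.
Context {d : measure_display} {T : measurableType d} {R : realType}.
Context {P : probability T R} {n : nat}.
Variable X : {RV P >-> n.-tuple R}.
Variable theta : n.-tuple R.
Hypothesis symX : unconditional X.
Hypothesis isoX : isotropic X.
Hypothesis theta1 : \sum_i tnth theta i ^+ 2 = 1.

Local Notation Ex F := (\int[P]_w (F w)).
Local Notation L1 F := (P.-integrable setT (EFin \o F)).
Local Notation X_ i := (fun w => component X i w).
Local Notation Y i := (fun w => summand theta i (X w)).
Local Notation W := (fun w => dot (X w) theta).
Local Notation th i := (tnth theta i).

Let mXi := measurable_component X.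
Let mY := measurable_summandX X theta.

Lemma isotropic_L1_sqr i : L1 (fun w => X_ i w ^+ 2).
Proof.
apply: L1_ge0; [exact: measurable_funX|by move=> w; exact: sqr_ge0|].
by have := isoX.2 i i; rewrite unlock eqxx => ->; rewrite ltry.
Qed.

Lemma isotropic_Ex_sqr i : Ex (fun w => X_ i w ^+ 2) = 1.
Proof. by have := isoX.2 i i; rewrite unlock eqxx /Rintegral => ->. Qed.

Lemma isotropic_L1_summand_sqr i : L1 (fun w => Y i w ^+ 2).
Proof.
apply: eq_integrable (L1Z (th i ^+ 2) (isotropic_L1_sqr i)) => // w _ /=.
by rewrite /summand exprMn mulrC.
Qed.

Let iY2 := isotropic_L1_summand_sqr.

Lemma isotropic_Ex_summand_sqr i : Ex (fun w => Y i w ^+ 2) = th i ^+ 2.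
Proof.
under eq_Rintegral do rewrite /summand exprMn.
by rewrite RintegralZr ?isotropic_Ex_sqr ?mul1r//; exact: isotropic_L1_sqr.
Qed.

Section signed_sum.
Variable K : R.
Hypothesis K0 : 0 <= K.
Local Notation S i := (fun w => signed_sqr K (Y i w)).

Let mS i : measurable_fun setT (S i).
Proof. exact: measurableT_comp (measurable_signed_sqr K) (mY i). Qed.

Let signed_sqr_sqr_le y : signed_sqr K y ^+ 2 <= K ^+ 2 * y ^+ 2.
Proof.
rewrite -real_normK ?num_real// norm_signed_sqr// exprMn real_normK ?num_real//.
rewrite mulrC ler_wpM2r ?sqr_ge0// ler_pXn2r// ?nnegrE ?le_min ?normr_ge0//.
by rewrite ge_min lexx orbT.
Qed.

Lemma L1_signed_sqr_sqr i : L1 (fun w => S i w ^+ 2).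
Proof.
apply: (L1_le _ (L1Z (K ^+ 2) (iY2 i))); first exact: measurable_funX.
by move=> w; rewrite ger0_norm ?sqr_ge0.
Qed.

Let iSS i j : L1 (fun w => S i w * S j w).
Proof. by apply: L1M => //; exact: L1_signed_sqr_sqr. Qed.

(** Reflecting the [i]-th coordinate changes the sign of one factor only. *)
Lemma signed_sqr_uncorrelated i j : i != j -> Ex (fun w => S i w * S j w) = 0.
Proof.
move=> ij; pose F x := signed_sqr K (summand theta i x) *
  signed_sqr K (summand theta j x).
have mF : measurable_fun setT F.
  by apply: measurable_funM; apply: (measurableT_comp (measurable_signed_sqr K));
     exact: measurable_summand.
have := @Ex_sign_flip _ _ _ _ _ X symX (fun k => k == i) F mF (iSS i j).
rewrite -[RHS]/(Ex (fun w => S i w * S j w)).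
have -> : Ex (fun w => F (sign_flip (fun k => k == i) (X w))) =
    - Ex (fun w => S i w * S j w).
  rewrite -mulN1r -RintegralZl//; apply: eq_Rintegral => w _.
  rewrite /F -/(reflect_at i _) !summand_reflect eqxx.
  by rewrite eq_sym (negbTE ij) signed_sqrN mulN1r mulNr.
lra.
Qed.

Lemma Ex_norm_signed_sum_le :
  Ex (fun w => `|\sum_i S i w|) <= Num.sqrt (\sum_i Ex (fun w => S i w ^+ 2)).
Proof.
have sqE w : (\sum_i S i w) ^+ 2 = \sum_i \sum_j S i w * S j w.
  by rewrite expr2 mulr_suml; apply: eq_bigr => i _; rewrite mulr_sumr.
have i2 : L1 (fun w => \sum_i \sum_j S i w * S j w).
  by apply: L1_sum => i _; apply: L1_sum.
apply: le_trans (Ex_norm_le_sqrt _ _) _.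
- exact: measurable_sum.
- by apply: eq_integrable i2 => // w _ /=; rewrite sqE.
rewrite le_eqVlt; apply/orP; left; apply/eqP; congr Num.sqrt.
under eq_Rintegral do rewrite sqE.
rewrite Ex_sum; last by move=> i; exact: L1_sum.
apply: eq_bigr => i _; rewrite Ex_sum// (bigD1 i)//= big1 ?addr0//.
by move=> j ji; apply: signed_sqr_uncorrelated; rewrite eq_sym.
Qed.

Lemma sum_Ex_signed_sqr_le : \sum_i Ex (fun w => S i w ^+ 2) <= K ^+ 2.
Proof.
rewrite -[leRHS]mulr1 -theta1 mulr_sumr; apply: ler_sum => i _.
rewrite -isotropic_Ex_summand_sqr -RintegralZl//; apply: le_Rintegral => //.
- exact: L1_signed_sqr_sqr.
- exact: L1Z.
Qed.

End signed_sum.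

Section fourth_moment.
Hypothesis iX4 : forall i, L1 (fun w => X_ i w ^+ 4).
Variables M C : R.
Hypothesis M_ge : forall i, Ex (fun w => X_ i w ^+ 4) <= M.
Hypothesis C_ge : forall i j, i != j ->
  Ex (fun w => X_ i w ^+ 2 * X_ j w ^+ 2) - 1 <= C.
Hypothesis C_gem1 : - 1 <= C.

Lemma L1_sqr_sqr i j : L1 (fun w => X_ i w ^+ 2 * X_ j w ^+ 2).
Proof.
by apply: L1M; [exact: measurable_funX..| |];
  apply: eq_integrable (iX4 _) => // w _ /=; rewrite -exprM.
Qed.

Let EF i j w : (1 - X_ i w ^+ 2) * (1 - X_ j w ^+ 2) =
  (1 - X_ i w ^+ 2) - (X_ j w ^+ 2 - X_ i w ^+ 2 * X_ j w ^+ 2).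
Proof. by ring. Qed.

Let iF i j : L1 (fun w => (1 - X_ i w ^+ 2) * (1 - X_ j w ^+ 2)).
Proof.
have iX2 := isotropic_L1_sqr.
apply: eq_integrable (L1B (L1B (L1_cst P 1) (iX2 i)) (L1B (iX2 j) (L1_sqr_sqr i j))) => //.
by move=> w _ /=; rewrite EF.
Qed.

Let ExF i j : Ex (fun w => (1 - X_ i w ^+ 2) * (1 - X_ j w ^+ 2)) =
  Ex (fun w => X_ i w ^+ 2 * X_ j w ^+ 2) - 1.
Proof.
have iX2 := isotropic_L1_sqr.
have ic := L1_cst P 1.
have iX22 := L1_sqr_sqr.
under eq_Rintegral do rewrite EF.
rewrite RintegralB//; [|exact: L1B|exact: L1B].
rewrite RintegralB// RintegralB// Ex_cst !isotropic_Ex_sqr; ring.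
Qed.

(** As [\sum_i th i ^+ 2 = 1], the expectation of the square is the average of
[E (1 - X_i ^+ 2) (1 - X_j ^+ 2)] with the weights [th i ^+ 2 * th j ^+ 2]. This
is at most [C] off the diagonal and [M - 1] on it; the excess [M - 1 - C] of the
diagonal is at most [M] because [C >= - 1]. *)
Lemma variance_le : Ex (fun w => `|1 - \sum_i Y i w ^+ 2|) <=
  Num.sqrt (M * (\sum_i th i ^+ 4) + C).
Proof.
have E1 w : 1 - \sum_i Y i w ^+ 2 = \sum_i th i ^+ 2 * (1 - X_ i w ^+ 2).
  rewrite -[X in X - _]theta1 -sumrB; apply: eq_bigr => i _.
  by rewrite /summand /component; ring.
have E2 w : (1 - \sum_i Y i w ^+ 2) ^+ 2 = \sum_i \sum_j
    (th i ^+ 2 * th j ^+ 2) * ((1 - X_ i w ^+ 2) * (1 - X_ j w ^+ 2)).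
  rewrite E1 expr2 mulr_suml; apply: eq_bigr => i _.
  by rewrite mulr_sumr; apply: eq_bigr => j _; rewrite mulrACA.
have iG i j : L1 (fun w => (th i ^+ 2 * th j ^+ 2) *
  ((1 - X_ i w ^+ 2) * (1 - X_ j w ^+ 2))) by exact: L1Z.
apply: le_trans (Ex_norm_le_sqrt _ _) _.
- apply: measurable_funB => //; apply: measurable_sum => i.
  exact: measurable_funX.
- have : L1 (fun w => \sum_i \sum_j (th i ^+ 2 * th j ^+ 2) *
    ((1 - X_ i w ^+ 2) * (1 - X_ j w ^+ 2))).
    by apply: L1_sum => i _; exact: L1_sum.
  by apply: eq_integrable => // w _ /=; rewrite E2.
apply: ler_wsqrtr.
under eq_Rintegral do rewrite E2.
rewrite Ex_sum; last by move=> i; exact: L1_sum.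
apply: (@le_trans _ _ (\sum_i \sum_j th i ^+ 2 * th j ^+ 2 *
    (C + (i == j)%:R * (M - 1 - C)))).
  apply: ler_sum => i _; rewrite Ex_sum//; apply: ler_sum => j _.
  rewrite RintegralZl// ExF.
  apply: ler_wpM2l; first by apply: mulr_ge0; exact: sqr_ge0.
  have [<-|ij] := eqVneq i j; last by rewrite mul0r addr0 C_ge.
  have -> : Ex (fun w => X_ i w ^+ 2 * X_ i w ^+ 2) = Ex (fun w => X_ i w ^+ 4).
    by apply: eq_Rintegral => w _; rewrite -exprD.
  have := M_ge i; rewrite mul1r; lra.
have -> : \sum_i \sum_j th i ^+ 2 * th j ^+ 2 *
    (C + (i == j)%:R * (M - 1 - C)) = C + (\sum_i th i ^+ 4) * (M - 1 - C).
  have -> : C + (\sum_i th i ^+ 4) * (M - 1 - C) =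
      \sum_i (th i ^+ 2 * C + th i ^+ 4 * (M - 1 - C)).
    by rewrite big_split/= -!mulr_suml theta1 mul1r.
  apply: eq_bigr => i _; under eq_bigr do rewrite mulrDr.
  rewrite big_split/= -mulr_suml -mulr_sumr theta1 mulr1; congr (_ + _).
  rewrite (bigD1 i)//= big1 ?addr0 => [|j ji]; first by rewrite eqxx mul1r -exprD.
  by rewrite eq_sym (negbTE ji) mul0r mulr0.
have q0 : 0 <= \sum_i th i ^+ 4.
  by apply: sumr_ge0 => i _; rewrite -[4%N]/(2 * 2)%N exprM sqr_ge0.
have C1 : 0 <= 1 + C by have := C_gem1; lra.
have := mulr_ge0 q0 C1; lra.
Qed.

End fourth_moment.
End moment_bounds.

(** * The bounds for finite fourth moments *)

Section numerics.
Context {R : realType}.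
Implicit Types y D v b c : R.

(** For [`|y| > 2^-1] this says that [(`|y| - 1) ^+ 2 >= 0]. *)
Lemma sqr_sub_signed_sqr_half_le y :
  y ^+ 2 - `|signed_sqr 2^-1 y| <= 2^-1 * `|y| ^+ 3.
Proof.
have a0 := normr_ge0 y.
rewrite norm_signed_sqr ?invr_ge0// -(real_normK (num_real y)).
have [_|_] := leP `|y| 2^-1.
  by rewrite -expr2 subrr mulr_ge0 ?invr_ge0// exprn_ge0.
have := mulr_ge0 a0 (sqr_ge0 (`|y| - 1)); lra.
Qed.

Lemma signed_sqr_half_sqr_le y :
  signed_sqr 2^-1 y ^+ 2 <= 2^-1 * `|y| ^+ 3.
Proof.
have a0 := normr_ge0 y; have a2 := sqr_ge0 `|y|.
rewrite -(real_normK (num_real (signed_sqr _ _))) norm_signed_sqr ?invr_ge0//.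
rewrite exprMn (_ : 2^-1 * `|y| ^+ 3 = `|y| ^+ 2 * (2^-1 * `|y|)); last by ring.
by apply: ler_wpM2l => //; have [h|h] := leP `|y| 2^-1; nra.
Qed.

(** From [pi <= 4] and [(7 / 6) ^+ 4 <= 2]. *)
Lemma powR_8_pi_ge : 7 / 6 <= (8 / pi : R) `^ (1 / 4).
Proof.
have pi4 : (pi : R) <= 4 by have := @pihalf_lt2 R; lra.
have h : (7 / 6 : R) ^+ 4 <= 8 / pi.
  rewrite ler_pdivlMr ?pi_gt0//.
  apply: (@le_trans _ _ ((7 / 6) ^+ 4 * 4)); last by lra.
  by rewrite ler_wpM2l// exprn_ge0// divr_ge0.
apply: (@le_trans _ _ (((7 / 6) ^+ 4) `^ (1 / 4))).
  rewrite -powR_mulrn ?divr_ge0// -powRrM mul1r mulfV ?pnatr_eq0//.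
  by rewrite powRr1// divr_ge0.
apply: ge0_ler_powR => //; rewrite ?nnegrE ?exprn_ge0 ?divr_ge0//.
exact: pi_ge0.
Qed.

(** The conclusion is trivial when [1 <= c * b]. Otherwise [b ^+ 2 / 2] is at most
[b / (2 * c)], and [(2 * c)^-1 + Num.sqrt 2^-1 <= 3 / 7 + 5 / 7 <= c]. *)
Lemma le1_absorb_sqr D v b c : 0 <= v -> 0 <= b -> 7 / 6 <= c -> D <= 1 ->
  D <= v + 2^-1 * b ^+ 2 + Num.sqrt (2^-1 * b ^+ 2) -> D <= v + c * b.
Proof.
move=> v0 b0 c1 D1 Db.
have [cb|cb] := leP 1 (c * b); first by lra.
have : Num.sqrt (2^-1 * b ^+ 2) <= 5 / 7 * b.
  rewrite -[leRHS]ger0_norm ?mulr_ge0 ?divr_ge0// -sqrtr_sqr ler_wsqrtr//.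
  by rewrite exprMn ler_wpM2r ?sqr_ge0//; lra.
move=> sb; apply: le_trans Db _; rewrite -addrA lerD2l.
apply: le_trans (lerD (lexx _) sb) _.
have b1 : b <= 6 / 7 by nra.
nra.
Qed.

End numerics.

Section berry_esseen.
Context {d : measure_display} {T : measurableType d} {R : realType}.
Context {P : probability T R} {n : nat}.
Variable X : {RV P >-> n.-tuple R}.
Variable theta : n.-tuple R.
Hypothesis symX : unconditional X.
Hypothesis isoX : isotropic X.
Hypothesis theta1 : \sum_i tnth theta i ^+ 2 = 1.

Local Notation Ex F := (\int[P]_w (F w)).
Local Notation L1 F := (P.-integrable setT (EFin \o F)).
Local Notation X_ i := (fun w => component X i w).
Local Notation Y i := (fun w => summand theta i (X w)).
Local Notation W := (fun w => dot (X w) theta).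
Local Notation th i := (tnth theta i).

Let mXi := measurable_component X.
Let mY := measurable_summandX X theta.
Let iX2 := isotropic_L1_sqr isoX.
Let iY2 := isotropic_L1_summand_sqr theta isoX.

Hypothesis iX4 : forall i, L1 (fun w => X_ i w ^+ 4).
Variables M C : R.
Hypothesis M_ge : forall i, Ex (fun w => X_ i w ^+ 4) <= M.
Hypothesis C_ge : forall i j, i != j ->
  Ex (fun w => X_ i w ^+ 2 * X_ j w ^+ 2) - 1 <= C.
Hypothesis C_gem1 : - 1 <= C.

Local Notation V := (Num.sqrt (M * (\sum_i th i ^+ 4) + C)).

Lemma L1_norm_cube i : L1 (fun w => `|X_ i w| ^+ 3).
Proof.
apply: (eq_integrable _ (EFin \o (fun w => `|X_ i w| * X_ i w ^+ 2))) => //.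
  by move=> w _ /=; rewrite -(real_normK (num_real (component X i w))) -exprS.
apply: L1M.
- exact: measurableT_comp.
- exact: measurable_funX.
- apply: eq_integrable (iX2 i) => // w _ /=.
  by rewrite real_normK ?num_real.
- by apply: eq_integrable (iX4 i) => // w _ /=; rewrite -exprM.
Qed.

Let iY3 i : L1 (fun w => `|Y i w| ^+ 3).
Proof.
apply: eq_integrable (L1Z (`|th i| ^+ 3) (L1_norm_cube i)) => // w _ /=.
by rewrite /summand normrM exprMn mulrC.
Qed.

(** [stein_bound] with the truncation level 1/2. With [B] the sum of the third
absolute moments of the summands, the truncation costs at most [B / 2] and the
signed squares contribute at most [Num.sqrt (B / 2)]; as the distance is at most
1, [B / 2] may be charged to [Num.sqrt B]. *)
Lemma third_moment_bound t (c r : R) : 7 / 6 <= c -> 0 <= r ->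
  (forall i, Num.sqrt (Ex (fun w => `|X_ i w| ^+ 3)) <= r) ->
  `|fine (P [set w | W w <= t]) - Phi t| <=
  2 * V + c * r * Num.sqrt (\sum_i `|th i| ^+ 3).
Proof.
move=> c1 r0 Xr; set D := `|_ - _|.
have h0 : 0 <= 2^-1 :> R by rewrite invr_ge0.
have D1 : D <= 1.
  have mA := measurable_dot_le X theta t.
  have p0 : 0 <= fine (P [set w | W w <= t]) by rewrite fine_ge0.
  have p1 : fine (P [set w | W w <= t]) <= 1.
    by rewrite -lee_fin fineK ?fin_num_measure// probability_le1.
  have := @Phi_ge0 R t; have := @Phi_le1 R t.
  by rewrite ler_norml => ? ?; apply/andP; split; lra.
pose B := \sum_i Ex (fun w => `|Y i w| ^+ 3).
have B0 : 0 <= B.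
  by apply: sumr_ge0 => i _; apply: Rintegral_ge0 => w _; exact: exprn_ge0.
have r1 : \sum_i Ex (fun w => Y i w ^+ 2 - `|signed_sqr 2^-1 (Y i w)|) <=
    2^-1 * B.
  rewrite mulr_sumr; apply: ler_sum => i _; rewrite -RintegralZl//.
  apply: le_Rintegral => //.
  - apply: L1B (iY2 i) (L1_norm _).
    apply: (L1_le _ (iY2 i)) => [|w]; last exact: norm_signed_sqr_le.
    exact: measurableT_comp (measurable_signed_sqr _) (mY i).
  - exact: L1Z.
  - by move=> w _; exact: sqr_sub_signed_sqr_half_le.
have r2 : \sum_i Ex (fun w => signed_sqr 2^-1 (Y i w) ^+ 2) <= 2^-1 * B.
  rewrite mulr_sumr; apply: ler_sum => i _; rewrite -RintegralZl//.
  apply: le_Rintegral => //.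
  - exact: L1_signed_sqr_sqr.
  - exact: L1Z.
  - by move=> w _; exact: signed_sqr_half_sqr_le.
have Br : Num.sqrt B <= r * Num.sqrt (\sum_i `|th i| ^+ 3).
  rewrite -{1}(ger0_norm r0) -sqrtr_sqr -sqrtrM ?sqr_ge0// ler_wsqrtr//.
  rewrite mulr_sumr; apply: ler_sum => i _.
  under eq_Rintegral do rewrite /summand normrM exprMn.
  rewrite RintegralZr//; last exact: L1_norm_cube.
  rewrite ler_wpM2r ?exprn_ge0//.
  have e0 : 0 <= Ex (fun w => `|X_ i w| ^+ 3).
    by apply: Rintegral_ge0 => w _; exact: exprn_ge0.
  by rewrite -(sqr_sqrtr e0) ler_pXn2r// ?nnegrE ?sqrtr_ge0.
have V0 : 0 <= V by exact: sqrtr_ge0.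
apply: (@le_trans _ _ (V + c * Num.sqrt B)).
  apply: le1_absorb_sqr => //; rewrite ?sqrtr_ge0// sqr_sqrtr//.
  apply: le_trans (stein_bound symX iY2 h0 t) _.
  apply: lerD; first apply: lerD => //.
    exact: variance_le.
  apply: le_trans (Ex_norm_signed_sum_le theta symX isoX h0) _.
  exact: ler_wsqrtr.
have c0 : 0 <= c by apply: le_trans c1.
rewrite -mulrA; apply: lerD; [lra|exact: ler_wpM2l].
Qed.

(** [stein_bound] truncated at the almost sure bound [K], which leaves no
remainder. The signed squares contribute at most [K], and [K <= n K ^+ 3] because
the second moments of the summands add up to 1, so that [1 <= n K ^+ 2]. *)
Lemma bounded_bound t (K : R) : 0 <= K ->
  {ae P, forall w, forall i, `|Y i w| <= K} ->
  `|fine (P [set w | W w <= t]) - Phi t| <= V + n%:R * K ^+ 3.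
Proof.
move=> K0 YK.
have r0 i : Ex (fun w => Y i w ^+ 2 - `|signed_sqr K (Y i w)|) = 0.
  rewrite -[RHS](Ex_cst P); apply: Ex_ae_eq => //.
    apply: measurable_funB; first exact: measurable_funX.
    apply: measurableT_comp => //.
    exact: measurableT_comp (measurable_signed_sqr _) (mY i).
  apply: filterS YK => w /(_ i) YK.
  by rewrite norm_signed_sqr// min_l// -expr2 real_normK ?num_real// subrr.
have e2 i : Ex (fun w => Y i w ^+ 2) <= K ^+ 2.
  rewrite (Ex_ae_eq (G := fun w => Num.min (Y i w ^+ 2) (K ^+ 2))).
  - rewrite -[leRHS](Ex_cst P); apply: le_Rintegral => //; last first.
    + by move=> w _; rewrite ge_min lexx orbT.
    + exact: L1_cst.
    apply: (L1_le _ (iY2 i)).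
      by apply: measurable_minr => //; exact: measurable_funX.
    move=> w; rewrite ger0_norm ?ge_min ?lexx//.
    by rewrite le_min !sqr_ge0.
  - exact: measurable_funX.
  - by apply: measurable_minr => //; exact: measurable_funX.
  - apply: filterS YK => w /(_ i) YK; rewrite min_l//.
    by rewrite -(real_normK (num_real (summand theta i (X w)))) ler_pXn2r// nnegrE.
have nK : 1 <= n%:R * K ^+ 2.
  rewrite -[leLHS]theta1 (_ : n%:R * K ^+ 2 = \sum_(i < n) K ^+ 2).
    apply: ler_sum => i _; apply: le_trans (e2 i).
    by rewrite isotropic_Ex_summand_sqr.
  by rewrite sumr_const card_ord mulr_natl.
apply: le_trans (stein_bound symX iY2 K0 t) _.
rewrite (eq_bigr _ (fun i _ => r0 i)) big1// addr0; apply: lerD.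
  exact: variance_le.
apply: le_trans (Ex_norm_signed_sum_le theta symX isoX K0) _.
apply: (@le_trans _ _ K); last by nra.
rewrite -[leRHS]ger0_norm// -sqrtr_sqr ler_wsqrtr//.
exact: sum_Ex_signed_sqr_le.
Qed.

End berry_esseen.

(** * The maxima of moments as extended reals *)

Section extended_reals.
Context {R : realType}.
Local Open Scope ereal_scope.

Lemma bigmaxe_EFin (I : finType) (A : pred I) (F : I -> \bar R) (g : I -> R)
    (i0 : I) : A i0 -> (forall i, A i -> F i = (g i)%:E) ->
  exists2 r : R, \big[maxe/-oo]_(i | A i) F i = r%:E &
    forall i, A i -> (g i <= r)%R.
Proof.
move=> Ai0 Fg; set m := \big[maxe/-oo]_(i | A i) F i.
have gm i : A i -> (g i)%:E <= m.
  by move=> Ai; rewrite -Fg//; exact: le_bigmax_cond.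
have mfin : m \is a fin_num.
  rewrite fin_numElt (lt_le_trans _ (gm _ Ai0)) ?ltNyr//=.
  by apply/bigmax_ltP; split => // i Ai; rewrite Fg// ltry.
exists (fine m); first by rewrite fineK.
by move=> i Ai; rewrite -lee_fin fineK// gm.
Qed.

Lemma lpnorm_exprn (n k : nat) (x : n.-tuple R) : (0 < k)%N ->
  (lpnorm k%:R x ^+ k = \sum_i `|tnth x i| ^+ k)%R.
Proof.
move=> k0; have S0 : (0 <= \sum_i `|tnth x i| ^+ k)%R.
  by apply: sumr_ge0 => i _; exact: exprn_ge0.
rewrite /lpnorm; under eq_bigr do rewrite powR_mulrn//.
rewrite -powR_mulrn ?powR_ge0// -powRrM mulVf ?pnatr_eq0 -?lt0n// powRr1//.
Qed.

Lemma lpnorm3_powR (n : nat) (x : n.-tuple R) :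
  (lpnorm 3 x `^ (3 / 2) = Num.sqrt (\sum_i `|tnth x i| ^+ 3))%R.
Proof.
have S0 : (0 <= \sum_i `|tnth x i| ^+ 3)%R.
  by apply: sumr_ge0 => i _; exact: exprn_ge0.
rewrite /lpnorm; under eq_bigr do rewrite powR_mulrn//.
by rewrite -powRrM (_ : 3^-1 * (3 / 2) = 2^-1)%R ?powR12_sqrt//; field.
Qed.

End extended_reals.

Section moments.
Context {d : measure_display} {T : measurableType d} {R : realType}.
Context {P : probability T R} {n : nat}.
Variable X : {RV P >-> n.-tuple R}.
Hypothesis n2 : (2 <= n)%N.
Hypothesis isoX : isotropic X.
Local Open Scope ereal_scope.

Local Notation Ex F := (\int[P]_w (F w))%R.
Local Notation L1 F := (P.-integrable setT (EFin \o F)).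
Local Notation X_ i := (fun w => component X i w).

Let i0 : 'I_n := Ordinal (ltn_trans (ltnSn 0) n2).
Let i1 : 'I_n := Ordinal n2.

Let mXi := measurable_component X.

Let covE i j :
  cov P (fun w => component X i w ^+ 2)%R (fun w => component X j w ^+ 2)%R =
  'E_P[fun w => (component X i w ^+ 2 * component X j w ^+ 2)%R] - 1.
Proof.
have E1 k : 'E_P[fun w => (component X k w ^+ 2)%R] = 1.
  by have := isoX.2 k k; rewrite eqxx.
by rewrite /cov !E1 mule1.
Qed.

Lemma cov_sqr_ge i j : - 1 <=
  cov P (fun w => component X i w ^+ 2)%R (fun w => component X j w ^+ 2)%R.
Proof.
rewrite covE -[leLHS]add0e leeD2r// expectation_ge0// => w.
by rewrite mulr_ge0 ?sqr_ge0.
Qed.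

Lemma max_cov_sqr_ge : - 1 <= max_cov_sqr X.
Proof.
apply: le_trans (cov_sqr_ge i0 i1) _.
exact: (@le_bigmax_cond _ _ _ _ (i0, i1) (fun ij => ij.1 != ij.2)).
Qed.

Lemma max_sqrt_moment3_ge0 : 0 <= max_sqrt_moment3 X.
Proof.
apply: le_trans (sqrte_ge0 'E_P[fun w => (`|component X i0 w| ^+ 3)%R]) _.
exact: le_bigmax.
Qed.

Lemma max_moment4_pinfty : ~ (forall i, L1 (fun w => component X i w ^+ 4)%R) ->
  max_moment4 X = +oo.
Proof.
move=> /existsNP[i nL1]; apply/eqP; rewrite -leye_eq.
apply: le_trans (le_bigmax _ _ i); rewrite leye_eq unlock.
apply/eqP; apply: contra_notP nL1 => /eqP Eoo.
apply: L1_ge0; first exact: measurable_funX.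
  by move=> w; rewrite -[4%N]/(2 * 2)%N exprM sqr_ge0.
by rewrite ltey.
Qed.

Hypothesis iX4 : forall i, L1 (fun w => component X i w ^+ 4)%R.

Let E_EFin F : L1 F -> 'E_P[F] = (Ex F)%:E.
Proof. by move=> iF; rewrite unlock; exact: Ex_EFin. Qed.

Lemma max_moment4_fin : exists2 M : R, max_moment4 X = M%:E &
  forall i, (Ex (fun w => component X i w ^+ 4) <= M)%R.
Proof.
have [|M ME MX] := @bigmaxe_EFin R 'I_n xpredT
  (fun i => 'E_P[fun w => (component X i w ^+ 4)%R])
  (fun i => Ex (fun w => component X i w ^+ 4)%R) i0 isT.
  by move=> i _; exact: E_EFin.
by exists M => // i; exact: MX.
Qed.

Lemma max_sqrt_moment3_fin : exists2 r : R, max_sqrt_moment3 X = r%:E &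
  forall i, (Num.sqrt (Ex (fun w => `|component X i w| ^+ 3)) <= r)%R.
Proof.
have [|r rE rX] := @bigmaxe_EFin R 'I_n xpredT
  (fun i => sqrte 'E_P[fun w => (`|component X i w| ^+ 3)%R])
  (fun i => Num.sqrt (Ex (fun w => `|component X i w| ^+ 3)))%R i0 isT.
  by move=> i _; rewrite E_EFin//; exact: L1_norm_cube.
by exists r => // i; exact: rX.
Qed.

Lemma max_cov_sqr_fin : exists2 C : R, max_cov_sqr X = C%:E &
  forall i j, i != j ->
  (Ex (fun w => component X i w ^+ 2 * component X j w ^+ 2) - 1 <= C)%R.
Proof.
have [|C CE CX] := @bigmaxe_EFin R ('I_n * 'I_n)%type (fun ij => ij.1 != ij.2)
  (fun ij => cov P (fun w => component X ij.1 w ^+ 2)%R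
     (fun w => component X ij.2 w ^+ 2)%R)
  (fun ij => Ex (fun w => component X ij.1 w ^+ 2 * component X ij.2 w ^+ 2) - 1)%R
  (i0, i1) isT.
  by move=> [i j] _; rewrite covE E_EFin//; exact: L1_sqr_sqr.
by exists C => // i j ij; exact: (CX (i, j) ij).
Qed.

End moments.

Section distance.
Context {d : measure_display} {T : measurableType d} {R : realType}.
Context {P : probability T R}.

Lemma dist_to_normal_le (W : T -> R) (b : R) :
  (forall t, measurable [set w | W w <= t]) ->
  (forall t, `|fine (P [set w | W w <= t]) - Phi t| <= b) ->
  (dist_to_normal P W <= b%:E)%E.
Proof.
move=> mW Wb; apply: ge_ereal_sup => _ [t _ <-].
have PE : P [set w | W w <= t] = (fine (P [set w | W w <= t]))%:E.
  by rewrite fineK// fin_num_measure.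
by rewrite PE std_normal_cdfE lee_fin Wb.
Qed.

End distance.

(** * The Berry-Esseen bounds *)

Local Open Scope ereal_scope.

Theorem corollary2 (R : realType) (d : measure_display) (T : measurableType d)
    (P : probability T R) (n : nat) (X : {RV P >-> n.-tuple R})
    (theta : n.-tuple R) :
  (2 <= n)%N -> unconditional X -> isotropic X ->
  lpnorm 2%R theta = 1%R ->
  let W := fun w : T => dot (X w) theta in
  dist_to_normal P W <=
    2%:E * sqrte (max_moment4 X * (lpnorm 4 theta ^+ 4)%R%:E + max_cov_sqr X)
    + ((8 / pi) `^ (1 / 4))%R%:E * max_sqrt_moment3 X
      * (lpnorm 3 theta `^ (3 / 2))%R%:E
  /\
  (forall a : R,
    {ae P, forall (w : T), forall (i : 'I_n), (- a <= component X i w <= a)%R} ->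
    dist_to_normal P W <=
      24%:E * sqrte (max_moment4 X * (lpnorm 4 theta ^+ 4)%R%:E + max_cov_sqr X)
      + (172 * n%:R * a ^+ 3 * linfnorm theta ^+ 3)%R%:E).
Proof.
move=> n2 symX isoX th2 W.
have theta1 : (\sum_i tnth theta i ^+ 2 = 1)%R.
  rewrite -[RHS](expr1n _ 2) -th2 lpnorm_exprn//.
  by apply: eq_bigr => i _; rewrite real_normK ?num_real.
have lp4 : (lpnorm 4 theta ^+ 4 = \sum_i tnth theta i ^+ 4)%R.
  rewrite lpnorm_exprn//; apply: eq_bigr => i _.
  by rewrite -[4%N]/(2 * 2)%N !exprM real_normK ?num_real.
have q0 : (0 < \sum_i tnth theta i ^+ 4)%R.
  have sq4 i : (0 <= tnth theta i ^+ 4)%R.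
    by rewrite -[4%N]/(2 * 2)%N exprM sqr_ge0.
  rewrite lt0r sumr_ge0// andbT; apply/eqP => /eqP.
  rewrite psumr_eq0// => /allP th0.
  have : (\sum_i tnth theta i ^+ 2 = 0 :> R)%R.
    apply: big1 => i _; have := th0 i (mem_index_enum i).
    by rewrite expf_eq0/= => /eqP ->; rewrite expr0n.
  by rewrite theta1 => /eqP; rewrite oner_eq0.
(* an infinite fourth moment makes both right-hand sides infinite *)
have [iX4|nX4] := pselect (forall i,
    P.-integrable setT (EFin \o (fun w => component X i w ^+ 4)%R)); last first.
  have infV : sqrte (max_moment4 X * (lpnorm 4 theta ^+ 4)%R%:E +
      max_cov_sqr X) = +oo.
    rewrite (max_moment4_pinfty nX4) gt0_mulye ?lte_fin ?lp4// addye//.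
    by have := max_cov_sqr_ge n2 isoX; case: max_cov_sqr.
  have inf (k : R) (x : \bar R) : (0 < k)%R -> x != -oo -> k%:E * +oo + x = +oo.
    by move=> k0 x0; rewrite gt0_muley ?lte_fin// addye.
  split=> [|a _]; rewrite infV inf ?leey//.
  rewrite gt_eqF// (lt_le_trans (ltNyr 0))// mule_ge0 ?lee_fin ?powR_ge0//.
  by rewrite mule_ge0 ?lee_fin ?powR_ge0 ?max_sqrt_moment3_ge0.
have [M -> XM] := max_moment4_fin n2 iX4.
have [r rE Xr] := max_sqrt_moment3_fin n2 isoX iX4.
have [C CE XC] := max_cov_sqr_fin n2 isoX iX4.
have r0 : (0 <= r)%R.
  by rewrite -lee_fin -rE max_sqrt_moment3_ge0.
have C1 : (- 1 <= C)%R by rewrite -lee_fin -CE max_cov_sqr_ge.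
rewrite rE CE lp4 lpnorm3_powR -EFinM -EFinD/=.
split=> [|a Xa].
  apply: dist_to_normal_le => t.
    exact: measurable_dot_le.
  exact: (third_moment_bound symX isoX theta1 iX4 XM XC C1 t (@powR_8_pi_ge R) r0 Xr).
apply: dist_to_normal_le => t.
  exact: measurable_dot_le.
have a0 : (0 <= a)%R.
  have : 0 < P setT by rewrite probability_setT.
  move=> /(@ae_properfilter_algebraOfSetsType _ _ _ P) PF.
  have [w /(_ (Ordinal n2))] := filter_ex Xa; lra.
have L0 : (0 <= linfnorm theta)%R by exact: bigmax_ge_id.
have YK : {ae P, forall w, forall i,
    (`|summand theta i (X w)| <= a * linfnorm theta)%R}.
  apply: filterS Xa => w Xa i; rewrite normrM; apply: ler_pM => //.
    by rewrite ler_norml; exact: Xa.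
  exact: (@le_bigmax _ R _ 0%R (fun i => `|tnth theta i|)%R i).
have K0 : (0 <= a * linfnorm theta)%R by exact: mulr_ge0.
apply: le_trans (bounded_bound symX isoX theta1 iX4 XM XC C1 t K0 YK) _.
rewrite exprMn; apply: lerD.
  by rewrite ler_peMl ?sqrtr_ge0// ler1n.
rewrite -!mulrA; apply: ler_peMl; last by rewrite ler1n.
by rewrite !mulr_ge0 ?exprn_ge0.
Qed.
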